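(* Suppose $\xi_y$, $y\in\mathbb{N}^2$, are i.i.d. and distributed as $\exp(\alpha)$, $\alpha>0$, and let $\beta>0$ be fixed. Then almost surely $$\lim_{N\to\infty}\frac1N\,G(N,\lfloor\beta N\rfloor)=\frac{(1+\sqrt\beta)^2}{\alpha}.$$ For each $\delta>0$ there exists $c=c(\delta)>0$ such that $$P\left\{\left|\frac1N\,G(N,\lfloor\beta N\rfloor)-\frac{(1+\sqrt\beta)^2}{\alpha}\right|>\delta\right\}\le e^{-cN}$$ for all $N\in\mathbb{N}$ with $\lfloor\beta N\rfloor\ge1$.
   Context: $\mathbb{N}=\{1,2,\dots\}$. $\exp(\alpha)$ is the exponential distribution with rate $\alpha$ (mean $1/\alpha$). For $N,M\in\mathbb{N}$, the last passage percolation value $G(N,M)$ on $\{1,\dots,N\}\times\{1,\dots,M\}$ is the maximum of $\sum_{j=1}^{N+M-1}\xi_{y_j}$ over all oriented paths $(y_1,\dots,y_{N+M-1})$ from $(1,1)$ to $(N,M)$, i.e. $y_{j+1}-y_j\in\{(1,0),(0,1)\}$. *)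

(* Defs.v *)
From HB Require Import structures.
From mathcomp Require Import all_boot all_order all_algebra.
From mathcomp Require Import finmap.
From mathcomp Require Import all_classical all_reals all_analysis.

Set Implicit Arguments.
Unset Strict Implicit.
Unset Printing Implicit Defensive.

Import Order.TTheory GRing.Theory Num.Theory.
Import numFieldNormedType.Exports.

Local Open Scope classical_set_scope.
Local Open Scope ring_scope.

(* The lattice {1, 2, ...}^2, as a subset of nat * nat. *)
Definition pos_quadrant : set (nat * nat) :=
  [set y | (0 < y.1)%N /\ (0 < y.2)%N].

Definition mutually_independent (d : measure_display) (T : measurableType d)
    (R : realType) (P : probability T R) (I : choiceType) (D : set I)
    (X : I -> {RV P >-> R}) : Prop :=
  forall (J : {fset I}) (A : I -> set R),
    [set` J] `<=` D ->
    (forall i, i \in J -> measurable (A i)) ->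
    P (\bigcap_(i in [set` J]) (X i @^-1` A i)) =
    (\prod_(i <- J) P (X i @^-1` A i))%E.

Definition identically_distributed (d : measure_display) (T : measurableType d)
    (R : realType) (P : probability T R) (I : Type) (D : set I)
    (X : I -> {RV P >-> R}) (mu : set R -> \bar R) : Prop :=
  forall i, D i -> forall A : set R, measurable A -> distribution P (X i) A = mu A.

Definition oriented_step (y z : nat * nat) : bool :=
  (z == (y.1.+1, y.2)) || (z == (y.1, y.2.+1)).

Definition oriented_path (N M : nat) (p : seq (nat * nat)) : Prop :=
  [/\ size p = (N + M - 1)%N,
      head (0, 0)%N p = (1, 1)%N,
      last (0, 0)%N p = (N, M)
    & sorted oriented_step p].

(* For N, M >= 1 the supremum ranges over a nonempty finite set, so it is a
   maximum: see [last_passage_max]. *)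
Definition last_passage (R : realType) (w : nat * nat -> R) (N M : nat) : R :=
  sup [set s | exists2 p, oriented_path N M p & s = \sum_(y <- p) w y].

Lemma oriented_path_exists (N M : nat) :
  (0 < N)%N -> (0 < M)%N -> exists p, oriented_path N M p.
Proof.
case: N => // N _; elim: M => // -[_ _|M IH _].
  elim: N => [|N [p [sp hp lp op]]]; first by exists [:: (1, 1)%N].
  case: p sp hp lp op => [|a p] //= sp hp lp op.
  exists (a :: rcons p (N.+2, 1)%N); split => //=.
  - by rewrite size_rcons sp !addn1 !subn1.
  - by rewrite last_rcons.
  - by rewrite rcons_path op /= /oriented_step lp eqxx.
have [//|p [sp hp lp op]] := IH.
case: p sp hp lp op => [|a p] /= sp hp lp op.
  by move: lp.
exists (a :: rcons p (N.+1, M.+2)); split => //=.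
- by rewrite size_rcons sp !addnS !subn1.
- by rewrite last_rcons.
- by rewrite rcons_path op /= /oriented_step lp eqxx orbT.
Qed.

Lemma oriented_path_bound (N M : nat) (p : seq (nat * nat)) :
  oriented_path N M p ->
  forall y, y \in p -> (y.1 < N.+1)%N && (y.2 < M.+1)%N.
Proof.
case=> _ _; case: p => [_ _ y|a p /= lp op]; first by rewrite in_nil.
elim: p a lp op => [|b p IH] a /=.
  by move=> -> _ y; rewrite inE => /eqP ->; rewrite /= !ltnSn.
move=> lp /andP[sab op] y.
rewrite inE => /orP[/eqP ->|]; last exact: IH.
have /andP[b1 b2] := IH b lp op b (mem_head _ _).
by case/orP: sab b1 b2 => /eqP -> /= b1 b2; apply/andP; split=> //; exact: ltnW.
Qed.

Lemma oriented_path_finite (N M : nat) : finite_set (oriented_path N M).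
Proof.
pose f (t : (N + M - 1).-tuple ('I_N.+1 * 'I_M.+1)) : seq (nat * nat) :=
  map (fun z => (val z.1, val z.2)) t.
apply: (@sub_finite_set _ _ (range f)); last exact: finite_image.
move=> p pp; have b := oriented_path_bound pp; have [sp _ _ _] := pp.
pose s := map (fun y : nat * nat => (inord y.1 : 'I_N.+1, inord y.2 : 'I_M.+1)) p.
have ss : size s == (N + M - 1)%N by rewrite size_map sp.
exists (Tuple ss) => //.
rewrite /f /= /s -map_comp -[RHS]map_id.
apply/eq_in_map => y /b /andP[y1 y2] /=.
by rewrite !inordK // -surjective_pairing.
Qed.

Lemma last_passage_max (R : realType) (w : nat * nat -> R) (N M : nat) :
  (0 < N)%N -> (0 < M)%N ->
  (exists2 p, oriented_path N M p & last_passage w N M = \sum_(y <- p) w y) /\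
  (forall p, oriented_path N M p -> \sum_(y <- p) w y <= last_passage w N M).
Proof.
move=> N0 M0; have [p0 pp0] := oriented_path_exists N0 M0.
have /finite_seqP[s sE] := oriented_path_finite N M.
have [q qs qmax] : exists2 q, q \in s &
    forall p, p \in s -> \sum_(y <- p) w y <= \sum_(y <- q) w y.
  have : p0 \in s by move: pp0; rewrite sE.
  clear; elim: s p0 => // a s IH p0 _.
  case: s IH => [_|b s IH].
    by exists a => [|p]; rewrite ?mem_head // inE => /eqP ->.
  have [q qs qmax] := IH b (mem_head _ _).
  case: (leP (\sum_(y <- a) w y) (\sum_(y <- q) w y)) => aq.
    exists q; first by rewrite inE qs orbT.
    by move=> p; rewrite inE => /orP[/eqP ->//|]; exact: qmax.
  exists a; first exact: mem_head.
  move=> p; rewrite inE => /orP[/eqP ->//|/qmax pq].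
  by rewrite (le_trans pq) // ltW.
have pq : oriented_path N M q by rewrite sE.
have max p : oriented_path N M p -> \sum_(y <- p) w y <= \sum_(y <- q) w y.
  by rewrite sE; exact: qmax.
have E : last_passage w N M = \sum_(y <- q) w y.
  apply/eqP; rewrite eq_le; apply/andP; split.
    apply: ge_sup; first by exists (\sum_(y <- q) w y), q.
    by move=> _ [p pp ->]; exact: max.
  apply: ub_le_sup; last by exists q.
  by exists (\sum_(y <- q) w y) => _ [p pp ->]; exact: max.
by split; [exists q | move=> p pp; rewrite E; exact: max].
Qed.

(* Main.v *)
Require Import Defs.
From HB Require Import structures.
From mathcomp Require Import all_boot all_order all_algebra.
From mathcomp Require Import finmap.
From mathcomp Require Import all_classical all_reals all_analysis.
From mathcomp Require Import measurable_realfun ring lra zify.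
Import Order.TTheory GRing.Theory Num.Theory.
Import numFieldNormedType.Exports.
Local Open Scope classical_set_scope.
Local Open Scope ring_scope.
Set Implicit Arguments.
Unset Strict Implicit.
Unset Printing Implicit Defensive.

(** The proof compares last passage percolation with its stationary version.
    Fix [a + b = alpha] with [a, b > 0] and put weights on the axes of the quadrant:
    independent exponentials of rate [a] on the horizontal axis and of rate [b] on
    the vertical one, weight 0 at the origin; the interior weights keep rate [alpha].
    Let [H n m] be the last passage value of this model, from the origin to [(n, m)].

    Burke's theorem.  If [X], [Y], [W] are independent exponentials of rates [a],
    [b], [a + b], then [(W + (X - Y)^+, W + (Y - X)^+, min X Y)] has the same law as
    [(X, Y, W)] ([burke_joint]).  Indeed [min X Y] is exponential of rate [a + b] and
    independent of [X - Y], by lack of memory; and the map above exchanges [min X Y]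
    with [W] and keeps [X - Y].  This is exactly how the increments of [H] across a
    lattice cell are updated ([hinc_rec], [vinc_rec]), so that sweeping the cells of
    a box one at a time shows that the horizontal increments of [H] along the top
    row are again independent exponentials of rate [a] ([expfam_top]).  Hence
    [H n m] is the sum of [m] independent exponentials of rate [b] and of [n]
    independent exponentials of rate [a], and Chernoff's bound gives exponential
    concentration of [H n m] around [n / a + m / b] ([stationary_tails]).

    Upper tail.  The last passage value of the interior is at most [H]
    ([upper_tail]).  The choice [a = alpha / (1 + sqrt beta)], [b = sqrt beta * a],
    which minimizes [1 / a + beta / b], makes [n / a + m / b] equal to the announced
    limit times [n] when [m = beta * n].

    Lower tail ([lower_tail]).  A maximal path for [H] follows one of the axes up
    to some point, at distance [k] from the origin, and then enters the interior
    ([lpp_exit]).  If [k > eps * N], the interior part is bounded by the upper tail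
    with the slightly modified rates [a - eta], [b + eta] (or [a + eta], [b - eta]
    for the other axis).  Since [(a, b)] is a minimizer, this costs only
    [O(eta ^ 2 * N)], whereas the axis part loses a multiple of [k * eta]
    ([detour_loss]); the total is smaller than the typical value of [H] by a
    multiple of [N].  So [k <= eps * N] outside an event of exponentially small
    probability, and the interior value is at least [H - O(eps) * N].

    The auxiliary axis weights need no extension of the probability space: they are
    rescaled copies of weights [xi y] with [y] outside of the box ([embed]).  The
    finitely many [N] not covered by these asymptotic bounds are handled by
    [deviation_lt1], and the almost sure limit follows by Borel-Cantelli. *)

(** * Equality of laws on generating families of sets *)

Lemma measure_unique_rays (R : realType) (m1 m2 : {measure set R -> \bar R}) :
  (m1 setT < +oo)%E -> m1 setT = m2 setT ->
  (forall t : R, m1 `]t, +oo[%classic = m2 `]t, +oo[%classic) ->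
  forall D, measurable D -> m1 D = m2 D.
Proof.
move=> m1oo hT h D mD.
pose C : set (set R) := [set C | C = setT \/ exists t : R, C = `]t, +oo[%classic].
apply: (measure_unique C (fun=> setT)) => //.
- pose G : set (set R) := @RGenOInfty.G R.
  have -> : measurable = <<s G >> := @RGenOInfty.measurableE R.
  apply/seteqP; split.
    apply: smallest_sub; first exact: smallest_sigma_algebra.
    by move=> _ [t ->]; apply: sub_sigma_algebra; right; exists t.
  apply: smallest_sub; first exact: smallest_sigma_algebra.
  move=> _ [->|[t ->]]; last by apply: sub_sigma_algebra; exists t.
  exact: (@measurableT _ (g_sigma_algebraType G)).
- move=> A B [->|[t ->]] [->|[s ->]]; rewrite ?setTI ?setIT.
  + by left.
  + by right; exists s.
  + by right; exists t.
  + right; exists (Num.max t s); apply/seteqP; split => x /=;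
      rewrite !in_itv/= !andbT gt_max; [case=> -> ->//|by move/andP].
- by left.
- by rewrite bigcup_const//; exists 0%N.
- by move=> _ [->|[t ->]]; rewrite ?hT ?h.
Qed.

Section probability_tools.
Context d (T : measurableType d) (R : realType) (P : probability T R).

(** Probabilities as nonnegative reals, the form in which scaling factors enter [mscale]. *)
Lemma probability_nneg_num (E : set T) : measurable E ->
  exists c : {nonneg R}, P E = c%:num%:E.
Proof.
move=> mE; have c0 : 0 <= fine (P E) by rewrite fine_ge0.
by exists (NngNum c0) => //=; rewrite fineK ?fin_num_measure.
Qed.

Lemma preimage_measurable d' (T' : measurableType d') (X : T -> T') (A : set T') :
  measurable_fun setT X -> measurable A -> measurable (X @^-1` A).
Proof. by move=> mX mA; rewrite -[X in measurable X]setTI; exact: mX. Qed.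

Lemma measurable_set_gt (X : T -> R) t : measurable_fun setT X -> measurable [set u | t < X u].
Proof.
move=> mX; have -> : [set u | t < X u] = X @^-1` `]t, +oo[.
  by apply/seteqP; split => u /=; rewrite in_itv/= andbT.
exact: preimage_measurable.
Qed.

Lemma measurable_set_ge (S : T -> R) (t : R) : measurable_fun setT S ->
  measurable [set u | t <= S u].
Proof.
move=> mS; have -> : [set u | t <= S u] = S @^-1` `[t, +oo[.
  by apply/seteqP; split => u /=; rewrite in_itv/= andbT.
exact: preimage_measurable.
Qed.

Lemma measurable_set_le (S : T -> R) (t : R) : measurable_fun setT S ->
  measurable [set u | S u <= t].
Proof.
move=> mS; have -> : [set u | S u <= t] = S @^-1` `]-oo, t].
  by apply/seteqP; split => u /=; rewrite in_itv.
exact: preimage_measurable.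
Qed.

(** Inclusion up to a null set. *)
Lemma le_measure_null (E F N0 : set T) : measurable E -> measurable F ->
  measurable N0 -> P N0 = 0%E -> E `<=` F `|` N0 -> (P E <= P F)%E.
Proof.
move=> mE mF mN N0E sub.
apply: (@le_trans _ _ (P (F `|` N0))).
  by apply: le_measure; rewrite ?inE//; exact: measurableU.
by rewrite -[leRHS]adde0 -N0E; exact: measureU2.
Qed.

Lemma union_bound2 (E F1 F2 : set T) (x y : R) : measurable E -> measurable F1 ->
  measurable F2 -> E `<=` F1 `|` F2 -> (P F1 <= x%:E)%E -> (P F2 <= y%:E)%E ->
  (P E <= (x + y)%:E)%E.
Proof.
move=> mE mF1 mF2 sub h1 h2.
apply: (@le_trans _ _ (P (F1 `|` F2))).
  by apply: le_measure; rewrite ?inE//; exact: measurableU.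
by rewrite EFinD (le_trans (measureU2 _ mF1 mF2))// leeD.
Qed.

Lemma union_boundn n (F : nat -> set T) (x : R) :
  (forall k, (k < n)%N -> measurable (F k) /\ (P (F k) <= x%:E)%E) ->
  measurable (\bigcup_(k in `I_n) F k) /\
  (P (\bigcup_(k in `I_n) F k) <= (n%:R * x)%:E)%E.
Proof.
elim: n => [|n IH] h.
  by rewrite II0 bigcup_set0 measure0 mul0r.
have [mU hU] : measurable (\bigcup_(k in `I_n) F k) /\
    (P (\bigcup_(k in `I_n) F k) <= (n%:R * x)%:E)%E.
  by apply: IH => k kn; apply: h; exact: ltnW.
have [mF hF] := h n (ltnSn n).
have -> : \bigcup_(k in `I_n.+1) F k = \bigcup_(k in `I_n) F k `|` F n.
  by rewrite IIS bigcup_setU bigcup_set1.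
split; first exact: measurableU.
rewrite -natr1 mulrDl mul1r.
by apply: union_bound2 hU hF => //; exact: measurableU.
Qed.

(** Two pairs of random variables, each restricted to an event, whose joint laws are
    proportional on rectangles have proportional joint laws. *)
Lemma pair_law_unique d1 d2 (T1 : measurableType d1) (T2 : measurableType d2)
    (X X' : T -> T1) (Y Y' : T -> T2) (E E' : set T) (c : {nonneg R}) :
  measurable_fun setT X -> measurable_fun setT X' ->
  measurable_fun setT Y -> measurable_fun setT Y' ->
  measurable E -> measurable E' ->
  (forall A B, measurable A -> measurable B ->
    P (X @^-1` A `&` Y @^-1` B `&` E) =
    (c%:num%:E * P (X' @^-1` A `&` Y' @^-1` B `&` E'))%E) ->
  forall D, measurable D ->
    P ((fun t => (X t, Y t)) @^-1` D `&` E) =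
    (c%:num%:E * P ((fun t => (X' t, Y' t)) @^-1` D `&` E'))%E.
Proof.
move=> mX mX' mY mY' mE mE' h D mD.
have mXY : measurable_fun setT (fun t => (X t, Y t)) by exact: measurable_fun_pair.
have mXY' : measurable_fun setT (fun t => (X' t, Y' t)) by exact: measurable_fun_pair.
pose m1 : {measure set (T1 * T2) -> \bar R} := pushforward (mrestr P mE) (fun t => (X t, Y t)).
pose m2 : {measure set (T1 * T2) -> \bar R} := mscale c (pushforward (mrestr P mE') (fun t => (X' t, Y' t))).
pose C : set (set (T1 * T2)) :=
  [set C | exists A, measurable A /\ exists B, measurable B /\ C = A `*` B].
rewrite -[LHS]/(m1 mXY D) -[RHS]/(m2 mXY' D).
apply: (measure_unique C (fun=> setT)) => //.
- rewrite measurable_prod_measurableType //; congr (<<s _ >>).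
  rewrite predeqE; split => [[A mA [B mB <-]]|[A [mA [B [mB ->]]]]].
    by exists A; split => //; exists B.
  by exists A => //; exists B.
- move=> /= _ _ [X1 [mX1 [X2 [mX2 ->]]]] [Y1 [mY1 [Y2 [mY2 ->]]]].
  rewrite -setXI; exists (X1 `&` Y1); split; first exact: measurableI.
  by exists (X2 `&` Y2); split => //; exact: measurableI.
- by move=> _; exists setT; split => //; exists setT; split => //; rewrite setXTT.
- by rewrite bigcup_const//; exists 0%N.
- by move=> _ [A [mA [B [mB ->]]]]; exact: h.
- move=> _; rewrite /m1 /= /pushforward /mrestr /= preimage_setT setTI.
  by rewrite (le_lt_trans (probability_le1 _ mE))// ltry.
Qed.

(** The analogue for a single real variable, with rays instead of rectangles. *)
Lemma ray_law_unique (X X' : T -> R) (E E' : set T) (c : {nonneg R}) :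
  measurable_fun setT X -> measurable_fun setT X' ->
  measurable E -> measurable E' ->
  P E = (c%:num%:E * P E')%E ->
  (forall t : R, P ([set u | (t < X u)%R] `&` E) =
    c%:num%:E * P ([set u | (t < X' u)%R] `&` E'))%E ->
  forall D, measurable D ->
    P (X @^-1` D `&` E) = (c%:num%:E * P (X' @^-1` D `&` E'))%E.
Proof.
move=> mX mX' mE mE' hE h D mD.
pose m1 : {measure set R -> \bar R} := pushforward (mrestr P mE) X.
pose m2 : {measure set R -> \bar R} := mscale c (pushforward (mrestr P mE') X').
rewrite -[LHS]/(m1 mX D) -[RHS]/(m2 mX' D); apply: measure_unique_rays => //.
- rewrite /m1 /= /pushforward /mrestr /= preimage_setT setTI.
  by rewrite (le_lt_trans (probability_le1 _ mE))// ltry.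
- rewrite /m1 /m2 /= /mscale /= /pushforward /mrestr /=.
  by rewrite !preimage_setT !setTI hE.
- move=> t; rewrite /m1 /m2 /= /mscale /= /pushforward /mrestr /=.
  have e (V : T -> R) : V @^-1` `]t, +oo[ = [set u | t < V u].
    by apply/seteqP; split => x /=; rewrite in_itv/= andbT.
  by rewrite !e h.
Qed.

End probability_tools.

(** * Burke's theorem for one lattice cell *)

Section burke.
Context d (T : measurableType d) (R : realType) (P : probability T R).
Implicit Types (X Y W : T -> R) (E F : set T) (a b c : R).

(** [X] is exponential of rate [c].  The law is encoded by its tail, which suffices by
    [ray_law_unique]; [Num.max t 0] covers negative [t], where the tail is 1. *)
Definition exp_law c X : Prop :=
  forall t : R, P [set u | t < X u] = (expR (- (c * Num.max t 0)))%:E.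

Lemma exp_law_memoryless c X s A : measurable_fun setT X -> exp_law c X ->
  0 <= s -> measurable A ->
  P ((fun u => X u - s) @^-1` A `&` [set u | s < X u]) =
  ((expR (- (c * s)))%:E * P (X @^-1` A))%E.
Proof.
move=> mX eX s0 mA.
rewrite -[X in (_ * P X)%E]setIT.
apply: (@ray_law_unique _ _ _ P _ X _ setT (NngNum (expR_ge0 (- (c * s))))) => //=.
- by apply: measurable_funB.
- exact: measurable_set_gt.
- by rewrite probability_setT mule1 eX (max_l s0).
- move=> t.
  have -> : [set u | t < X u - s] `&` [set u | s < X u] =
            [set u | s + Num.max t 0 < X u].
    by apply/seteqP; split => u /=; rewrite -ltrBrDl gt_max subr_gt0;
      [move=> [-> ->]|move=> /andP[]].
  rewrite setIT !eX -EFinM -expRD; congr (expR _)%:E.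
  have h : 0 <= Num.max t 0 by rewrite le_max lexx orbT.
  by rewrite max_l ?addr_ge0//; ring.
Qed.

(** Lack of memory in both coordinates: on [{X > s, Y > s}] the pair [(X - s, Y - s)] has,
    up to a factor, the law of [(X, Y)], and both pairs have the same difference. *)
Lemma min_diff_tail a b X Y F B s :
  measurable_fun setT X -> measurable_fun setT Y -> measurable F -> measurable B ->
  exp_law a X -> exp_law b Y ->
  (forall A A', measurable A -> measurable A' ->
    P (X @^-1` A `&` Y @^-1` A' `&` F) = (P (X @^-1` A) * P (Y @^-1` A') * P F)%E) ->
  P ([set u | s < Num.min (X u) (Y u)] `&` ((fun u => (X u - Y u)%R) @^-1` B `&` F)) =
  ((expR (- ((a + b) * Num.max s 0)))%:E * P ((fun u => (X u - Y u)%R) @^-1` B `&` F))%E.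
Proof.
move=> mX mY mF mB eX eY ind.
have mXY : measurable_fun setT (fun u => (X u - Y u)%R) by exact: measurable_funB.
have mG : measurable ((fun u => (X u - Y u)%R) @^-1` B `&` F).
  by apply: measurableI => //; exact: preimage_measurable.
have mm r : measurable [set u | r < Num.min (X u) (Y u)].
  by apply: measurable_set_gt; exact: measurable_minr.
suff H r : 0 <= r -> P ([set u | r < Num.min (X u) (Y u)] `&` ((fun u => (X u - Y u)%R) @^-1` B `&` F)) =
  ((expR (- ((a + b) * r)))%:E * P ((fun u => (X u - Y u)%R) @^-1` B `&` F))%E.
  (* For [s < 0] the event [{s < min X Y}] lies between [{0 < min X Y}] and the whole space. *)
  have [s0|s0] := leP 0 s; first by rewrite H.
  rewrite mulr0 oppr0 expR0 mul1e; apply/eqP; rewrite eq_le; apply/andP; split.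
    by apply: le_measure; rewrite ?inE//; exact: measurableI.
  have := H 0 (lexx _); rewrite mulr0 oppr0 expR0 mul1e => <-.
  apply: le_measure; rewrite ?inE//; [exact: measurableI|exact: measurableI|].
  by apply: setSI => u /=; exact: lt_trans.
move=> r0.
have mD : measurable [set p : R * R | B (p.1 - p.2)].
  rewrite -[X in measurable X]setTI.
  by apply: (measurable_funB measurable_fst measurable_snd).
have := @pair_law_unique _ _ _ P _ _ R R (fun u => X u - r) X (fun u => Y u - r) Y
  ([set u | r < X u] `&` [set u | r < Y u] `&` F) F (NngNum (expR_ge0 (- ((a + b) * r)))).
move=> /(_ _ _ _ _ _ _ _ _ mD) <- //=.
- congr (P _); apply/seteqP; split => u /=.
    by rewrite lt_min => -[/andP[-> ->] [h f]]; split => //; rewrite opprB addrA subrK.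
  by rewrite lt_min => -[h [[-> ->] f]]; split => //; split => //; move: h; rewrite opprB addrA subrK.
- by apply: measurable_funB.
- by apply: measurable_funB.
- by apply: measurableI => //; apply: measurableI; exact: measurable_set_gt.
- move=> A A' mA mA'.
  pose S (A : set R) := [set x : R | A (x - r)] `&` [set x | r < x].
  have mS (C : set R) : measurable C -> measurable (S C).
    move=> mC; apply: measurableI; last first.
      have -> : [set x : R | r < x] = `]r, +oo[%classic.
        by apply/seteqP; split => u /=; rewrite in_itv/= andbT.
      exact: measurable_itv.
    have mr : measurable_fun setT (fun x : R => x - r) by exact: measurable_funB.
    by rewrite -[X in measurable X]setTI; exact: mr.
  transitivity (P (X @^-1` S A `&` Y @^-1` S A' `&` F)).
    by congr (P _); apply/seteqP; split => u /=; rewrite /S/=; tauto.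
  rewrite ind//; try exact: mS.
  have -> : X @^-1` S A = (fun u => X u - r) @^-1` A `&` [set u | r < X u] by [].
  have -> : Y @^-1` S A' = (fun u => Y u - r) @^-1` A' `&` [set u | r < Y u] by [].
  rewrite (exp_law_memoryless mX eX)// (exp_law_memoryless mY eY)// ind//.
  rewrite mulrDl opprD expRD EFinM !muleA; congr (_ * _)%E; congr (_ * _)%E.
  by rewrite -!muleA; congr (_ * _)%E; rewrite muleC.
Qed.

(** [X \min Y] has the law of [W] and is independent of [X \- Y]. *)
Lemma min_diff_law a b X Y W F A B :
  measurable_fun setT X -> measurable_fun setT Y -> measurable_fun setT W ->
  measurable F -> measurable A -> measurable B ->
  exp_law a X -> exp_law b Y -> exp_law (a + b) W ->
  (forall A A', measurable A -> measurable A' ->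
    P (X @^-1` A `&` Y @^-1` A' `&` F) = (P (X @^-1` A) * P (Y @^-1` A') * P F)%E) ->
  P ((X \min Y)%R @^-1` A `&` (X \- Y)%R @^-1` B `&` F) =
  (P (W @^-1` A) * P ((X \- Y)%R @^-1` B `&` F))%E.
Proof.
move=> mX mY mW mF mA mB eX eY eW ind.
have mG : measurable ((X \- Y)%R @^-1` B `&` F).
  by apply: measurableI => //; apply: preimage_measurable => //; exact: measurable_funB.
have [c cE] := probability_nneg_num P mG.
rewrite -setIA cE muleC -[W @^-1` A]setIT.
apply: (@ray_law_unique _ _ _ P (X \min Y)%R W _ setT c) => //.
- exact: measurable_minr.
- by rewrite probability_setT mule1.
- move=> t; rewrite setIT eW -cE muleC.
  exact: min_diff_tail.
Qed.

(** [X], [Y], [W] and the event [E] are independent. *)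
Definition product_law X Y W E := forall A B C, measurable A -> measurable B -> measurable C ->
    P (X @^-1` A `&` Y @^-1` B `&` W @^-1` C `&` E) =
    (P (X @^-1` A) * P (Y @^-1` B) * P (W @^-1` C) * P E)%E.

(** The update map of a cell preserves the law of [(X, Y, W)], jointly with any independent
    event [E]. *)
Lemma burke_joint a b X Y W E :
  measurable_fun setT X -> measurable_fun setT Y -> measurable_fun setT W ->
  measurable E ->
  exp_law a X -> exp_law b Y -> exp_law (a + b) W ->
  product_law X Y W E ->
  forall A B C, measurable A -> measurable B -> measurable C ->
    P ((fun u => W u + Num.max (X u - Y u) 0)%R @^-1` A `&`
       (fun u => W u + Num.max (Y u - X u) 0)%R @^-1` B `&`
       (X \min Y)%R @^-1` C `&` E) =
    P (X @^-1` A `&` Y @^-1` B `&` W @^-1` C `&` E).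
Proof.
move=> mX mY mW mE eX eY eW ind A B C mA mB mC.
have mm : measurable_fun setT (X \min Y)%R by exact: measurable_minr.
have mu : measurable_fun setT (X \- Y)%R by exact: measurable_funB.
have mWC D : measurable D -> measurable (W @^-1` D `&` E).
  by move=> mD; apply: measurableI => //; exact: preimage_measurable.
have WE D : measurable D -> P (W @^-1` D `&` E) = (P (W @^-1` D) * P E)%E.
  move=> mD; have := ind _ _ _ measurableT measurableT mD.
  by rewrite !preimage_setT !setTI probability_setT !mul1e.
have ind2 D : measurable D -> forall A1 A2, measurable A1 -> measurable A2 ->
   P (X @^-1` A1 `&` Y @^-1` A2 `&` (W @^-1` D `&` E)) =
   (P (X @^-1` A1) * P (Y @^-1` A2) * P (W @^-1` D `&` E))%E.
  by move=> mD A1 A2 mA1 mA2; rewrite setIA ind// WE// !muleA.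
have uW D B' : measurable D -> measurable B' ->
   P ((X \- Y)%R @^-1` B' `&` (W @^-1` D `&` E)) =
   (P (W @^-1` D) * P ((X \- Y)%R @^-1` B' `&` E))%E.
  move=> mD mB'.
  have [c cE] := probability_nneg_num P (preimage_measurable mW mD).
  rewrite cE.
  have mD' : measurable [set p : R * R | B' (p.1 - p.2)].
    rewrite -[X in measurable X]setTI.
    by apply: (measurable_funB measurable_fst measurable_snd).
  apply: (@pair_law_unique _ _ _ P _ _ R R X X Y Y (W @^-1` D `&` E) E c _ _ _ _ _ _ _ _ mD') => //.
    exact: mWC.
  move=> A1 A2 mA1 mA2; rewrite ind2// WE// -cE.
  have := ind _ _ _ mA1 mA2 measurableT.
  rewrite preimage_setT setIT probability_setT mule1 => ->.
  by rewrite !muleA; congr (_ * _)%E; rewrite -muleA muleC.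
have muw A' B' D : measurable A' -> measurable B' -> measurable D ->
    P ((X \min Y)%R @^-1` A' `&` (X \- Y)%R @^-1` B' `&` (W @^-1` D `&` E)) =
    (P (W @^-1` A') * (P (W @^-1` D) * P ((X \- Y)%R @^-1` B' `&` E)))%E.
  move=> mA' mB' mD; rewrite (min_diff_law mX mY mW _ mA' mB' eX eY eW)//.
  - by rewrite uW.
  - exact: mWC.
  - exact: ind2.
(* The triples [(X \min Y, X \- Y, W)] and [(W, X \- Y, X \min Y)] have the same law: the
   exchange is made first for the pair of its first two components, then for the triple. *)
have c1 : (1 = (NngNum (@ler01 R))%:num%:E :> \bar R)%E by [].
have step1 D A' : measurable D -> measurable A' ->
   P ((fun t => ((X \min Y)%R t, (X \- Y)%R t)) @^-1` D `&` (W @^-1` A' `&` E)) =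
   P ((fun t => (W t, (X \- Y)%R t)) @^-1` D `&` ((X \min Y)%R @^-1` A' `&` E)).
  move=> mD mA'; rewrite -[RHS]mul1e c1.
  apply: pair_law_unique mD => //; first exact: mWC.
    by apply: measurableI => //; exact: preimage_measurable.
  move=> A1 A2 mA1 mA2; rewrite mul1e muw//.
  transitivity (P ((X \min Y)%R @^-1` A' `&` (X \- Y)%R @^-1` A2 `&` (W @^-1` A1 `&` E))).
    by rewrite muw// muleCA.
  by congr (P _); apply/seteqP; split => u /=; tauto.
have step2 D : measurable D ->
   P ((fun t => (((X \min Y)%R t, (X \- Y)%R t), W t)) @^-1` D `&` E) =
   P ((fun t => ((W t, (X \- Y)%R t), (X \min Y)%R t)) @^-1` D `&` E).
  move=> mD; rewrite -[RHS]mul1e c1.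
  apply: pair_law_unique mD => //; try exact: measurable_fun_pair.
  by move=> A1 A2 mA1 mA2; rewrite mul1e -!setIA step1.
(* Applied to the first triple, [(f1, f2, snd)] returns [(X, Y, W)]; applied to the second
   one, it returns the updated variables. *)
pose f1 (p : R * R * R) := p.1.1 + Num.max p.1.2 0.
pose f2 (p : R * R * R) := p.1.1 + Num.max (- p.1.2) 0.
have m11 : measurable_fun setT (fun p : R * R * R => p.1.1).
  exact: (measurableT_comp measurable_fst measurable_fst).
have m12 : measurable_fun setT (fun p : R * R * R => p.1.2).
  exact: (measurableT_comp measurable_snd measurable_fst).
have mf1 : measurable_fun setT f1.
  by apply: measurable_funD => //; exact: measurable_maxr.
have mf2 : measurable_fun setT f2.
  by apply: measurable_funD => //; apply: measurable_maxr => //; exact: measurable_funN.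
pose D := f1 @^-1` A `&` f2 @^-1` B `&` (snd @^-1` C).
have mD : measurable D.
  by apply: measurableI; [apply: measurableI|]; rewrite -[X in measurable X]setTI;
    [exact: mf1|exact: mf2|exact: measurable_snd].
have := step2 _ mD.
have -> : (fun t => (((X \min Y)%R t, (X \- Y)%R t), W t)) @^-1` D `&` E =
  X @^-1` A `&` Y @^-1` B `&` W @^-1` C `&` E.
  have e1 t : Num.min (X t) (Y t) + Num.max (X t - Y t) 0 = X t.
    by case: (leP (X t) (Y t)) => h; [rewrite max_r|rewrite max_l]; lra.
  have e2 t : Num.min (X t) (Y t) + Num.max (- (X t - Y t)) 0 = Y t.
    by case: (leP (X t) (Y t)) => h; [rewrite max_l|rewrite max_r]; lra.
  by apply/seteqP; split => t; rewrite /D /f1 /f2 /= e1 e2.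
move=> ->; congr (P _).
by apply/seteqP; split => t; rewrite /D /f1 /f2 /= opprB.
Qed.

End burke.

(** * Families of independent exponential variables *)

Section exp_families.
Context d (T : measurableType d) (R : realType) (P : probability T R).
Context (K : eqType).
Implicit Types (s : seq K) (X : K -> T -> R) (A : K -> set R) (r : K -> R).

(** The cylinder event [X k \in A k] for all [k] in [s]. *)
Definition rect s X A : set T := \big[setI/setT]_(k <- s) X k @^-1` A k.

Lemma rect_cons k s X A : rect (k :: s) X A = X k @^-1` A k `&` rect s X A.
Proof. by rewrite /rect big_cons. Qed.

Lemma measurable_rect s X A : (forall k, measurable_fun setT (X k)) ->
  (forall k, measurable (A k)) -> measurable (rect s X A).
Proof.
move=> mX mA; rewrite /rect; elim/big_ind : _ => //.
- exact: measurableI.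
- by move=> k _; exact: preimage_measurable.
Qed.

Lemma eq_rect s X X' A A' : (forall k, k \in s -> X k @^-1` A k = X' k @^-1` A' k) ->
  rect s X A = rect s X' A'.
Proof. by move=> h; rewrite /rect; apply: eq_big_seq. Qed.

Lemma rect_single s X A k : uniq s -> k \in s ->
  (forall y, y != k -> A y = setT) -> rect s X A = X k @^-1` A k.
Proof.
move=> us ks h; rewrite /rect (bigD1_seq k)//= big1 ?setIT//.
by move=> y yk; rewrite h// preimage_setT.
Qed.

(** The variables [X k], for [k] in [s], are mutually independent and exponential, [X k]
    having rate [r k]. *)
Definition expfam s r X : Prop :=
  [/\ uniq s, forall k, measurable_fun setT (X k),
      forall A, (forall k, measurable (A k)) ->
        P (rect s X A) = (\prod_(k <- s) P (X k @^-1` A k))%E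
    & forall k, k \in s -> exp_law P (r k) (X k)].

Lemma expfam_perm s s' r X : perm_eq s s' -> expfam s r X -> expfam s' r X.
Proof.
move=> ss [us mX iX eX]; split=> //.
- by rewrite -(perm_uniq ss).
- by move=> A mA; rewrite /rect -(perm_big _ ss) -[LHS]/(P (rect s X A)) iX// (perm_big _ ss).
- by move=> k; rewrite -(perm_mem ss); exact: eX.
Qed.

Lemma expfam_cat s s' r X : expfam (s ++ s') r X -> expfam s r X.
Proof.
move=> [us mX iX eX]; split=> //.
- by move: us; rewrite cat_uniq => /andP[].
- move=> A mA; pose A' k := if k \in s then A k else setT.
  have := iX A'; have mA' k : measurable (A' k) by rewrite /A'; case: ifP.
  move=> /(_ mA'); rewrite /rect !big_cat /=.
  rewrite [X in _ `&` X]big1_seq ?setIT; last first.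
    move=> k ks; rewrite /A' ifF ?preimage_setT//; apply/negbTE/negP => ks1.
    by move: us; rewrite cat_uniq => /and3P[_ /hasPn/(_ _ ks)]; rewrite ks1.
  rewrite [X in (_ * X)%E]big1_seq ?mule1; last first.
    move=> k ks; rewrite /A' ifF ?preimage_setT ?probability_setT//; apply/negbTE/negP => ks1.
    by move: us; rewrite cat_uniq => /and3P[_ /hasPn/(_ _ ks)]; rewrite ks1.
  have e k : k \in s -> A' k = A k by rewrite /A' => ->.
  rewrite (eq_big_seq (fun k => X k @^-1` A k)); last by move=> k ks; rewrite e.
  by rewrite (eq_big_seq (fun k => P (X k @^-1` A k)))//; move=> k ks; rewrite e.
- by move=> k ks; apply: eX; rewrite mem_cat ks.
Qed.

Lemma expfam_sub s s' r X : uniq s' -> {subset s' <= s} -> expfam s r X -> expfam s' r X.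
Proof.
move=> us' ss fX; apply: (@expfam_cat _ [seq k <- s | k \notin s']).
have [us _ _ _] := fX; apply: expfam_perm fX.
apply: uniq_perm => //.
- rewrite cat_uniq us' filter_uniq// andbT; apply/hasPn => k.
  by rewrite mem_filter => /andP[].
- move=> k; rewrite mem_cat mem_filter; case: (boolP (k \in s')) => //= ks'.
  exact: ss.
Qed.

(** A family with the same joint law on cylinders is again independent exponential, with
    the same rates. *)
Lemma same_law_expfam s r X X' : expfam s r X ->
  (forall k, measurable_fun setT (X' k)) ->
  (forall A, (forall k, measurable (A k)) -> P (rect s X' A) = P (rect s X A)) ->
  expfam s r X'.
Proof.
move=> [us mX iX eX] mX' h.
have marg k B : k \in s -> measurable B -> P (X' k @^-1` B) = P (X k @^-1` B).
  move=> ks mB; pose A y := if y == k then B else setT.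
  have mA y : measurable (A y) by rewrite /A; case: ifP.
  have := h A mA; rewrite !(@rect_single _ _ _ k)//.
  - by rewrite /A eqxx.
  - by move=> y /negbTE yk; rewrite /A yk.
  - by move=> y /negbTE yk; rewrite /A yk.
split=> //.
- by move=> A mA; rewrite h// iX//; apply: eq_big_seq => k ks; rewrite marg.
- move=> k ks t; have := eX k ks t.
  have e (V : T -> R) : [set u | t < V u] = V @^-1` `]t, +oo[.
    by apply/seteqP; split => x /=; rewrite in_itv/= andbT.
  by rewrite !e marg.
Qed.

(** The cell update at the horizontal increment [i], the vertical increment [j] and the
    weight [k]; keeping [X i \min X j] at the index [k] leaves the index set unchanged. *)
Definition burke_update i j k X : K -> T -> R := fun y =>
  if y == i then fun u => X k u + Num.max (X i u - X j u) 0
  else if y == j then fun u => X k u + Num.max (X j u - X i u) 0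
  else if y == k then X i \min X j
  else X y.

Lemma expfam_burke s r X i j k : expfam s r X ->
  [/\ i \in s, j \in s & k \in s] -> [/\ i != j, i != k & j != k] ->
  r k = r i + r j -> expfam s r (burke_update i j k X).
Proof.
move=> fX [si sj sk] [ij ik jk] rk.
have [us mX _ _] := fX.
pose s' := [seq y <- s | y \notin [:: i; j; k]].
have ss : perm_eq s ([:: i; j; k] ++ s').
  apply: uniq_perm => //.
    rewrite cat_uniq filter_uniq// andbT/= !inE negb_or ij ik jk/=.
    by apply/hasPn => y; rewrite mem_filter => /andP[].
  move=> y; rewrite mem_cat mem_filter; case: (boolP (y \in [:: i; j; k])) => //=.
  by rewrite !inE => /or3P[]/eqP ->.
have mX' y : measurable_fun setT (burke_update i j k X y).
  rewrite /burke_update; case: (y == i); [|case: (y == j); [|case: (y == k) => //]].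
  - by apply: measurable_funD => //; apply: measurable_maxr => //; exact: measurable_funB.
  - by apply: measurable_funD => //; apply: measurable_maxr => //; exact: measurable_funB.
  - exact: measurable_minr.
have {}fX := expfam_perm ss fX.
have [us' _ iX eX] := fX.
apply: (@expfam_perm ([:: i; j; k] ++ s')); first by rewrite perm_sym.
apply: (same_law_expfam fX) => //.
move=> A mA /=; rewrite !rect_cons.
have s'N y : y \in s' -> [/\ y != i, y != j & y != k].
  by rewrite mem_filter !inE !negb_or => /andP[/and3P[]].
have -> : rect s' (burke_update i j k X) A = rect s' X A.
  apply: eq_rect => y /s'N[yi yj yk].
  by rewrite /burke_update (negbTE yi) (negbTE yj) (negbTE yk).
have [ji ki kj] : [/\ j == i = false, k == i = false & k == j = false].
  by split; apply/negbTE; rewrite eq_sym.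
have Ei : burke_update i j k X i = fun u => X k u + Num.max (X i u - X j u) 0.
  by rewrite /burke_update eqxx.
have Ej : burke_update i j k X j = fun u => X k u + Num.max (X j u - X i u) 0.
  by rewrite /burke_update ji eqxx.
have Ek : burke_update i j k X k = X i \min X j by rewrite /burke_update ki kj eqxx.
rewrite Ei Ej Ek.
have mE := measurable_rect s' mX mA.
have h : product_law P (X i) (X j) (X k) (rect s' X A).
  move=> A1 A2 A3 mA1 mA2 mA3.
  (* Independence of the whole family, tested on sets modified at [i], [j] and [k]. *)
  pose A' y := if y == i then A1 else if y == j then A2 else if y == k then A3 else A y.
  have mA' y : measurable (A' y) by rewrite /A'; case: ifP => // _; case: ifP => // _; case: ifP.
  have E' : rect s' X A' = rect s' X A.
    apply: eq_rect => y /s'N[yi yj yk].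
    by rewrite /A' (negbTE yi) (negbTE yj) (negbTE yk).
  have := iX A' mA'; rewrite /= !rect_cons !big_cons E'.
  have fs' : expfam s' r X.
    apply: expfam_sub fX; first by move: us'; rewrite cat_uniq => /and3P[].
    by move=> y ys; rewrite mem_cat ys orbT.
  have [_ _ /(_ A' mA') <- _] := fs'; rewrite E'.
  have -> : A' i = A1 by rewrite /A' eqxx.
  have -> : A' j = A2 by rewrite /A' ji eqxx.
  have -> : A' k = A3 by rewrite /A' ki kj eqxx.
  by rewrite !muleA !setIA.
rewrite !setIA; apply: (@burke_joint _ _ _ P (r i) (r j)) => //.
- by apply: eX; rewrite mem_cat mem_head.
- by apply: eX; rewrite mem_cat !inE eqxx orbT.
- by rewrite -rk; apply: eX; rewrite mem_cat !inE eqxx !orbT.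
Qed.

End exp_families.

Section expfam_transfer.
Context d (T : measurableType d) (R : realType) (P : probability T R).

Lemma expfam_ext (K : eqType) (s : seq K) r (X X' : K -> T -> R) :
  (forall k, measurable_fun setT (X' k)) -> (forall k, k \in s -> X' k = X k) ->
  expfam P s r X -> expfam P s r X'.
Proof.
move=> mX' e fX; apply: same_law_expfam fX mX' _ => A mA.
by congr (P _); apply: eq_rect => k /e ->.
Qed.

Lemma expfam_rate (K : eqType) (s : seq K) r r' (X : K -> T -> R) :
  (forall k, k \in s -> r k = r' k) -> expfam P s r X -> expfam P s r' X.
Proof. by move=> e [us mX iX eX]; split=> // k ks; rewrite -e//; exact: eX. Qed.

Lemma expfam_map (K K' : eqType) (k0 : K) (f : K -> K') (s : seq K) r (X : K' -> T -> R) :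
  expfam P [seq f k | k <- s] r X -> expfam P s (r \o f) (X \o f).
Proof.
move=> [us mX iX eX]; have us' := map_uniq us.
split=> //.
- by move=> k; exact: mX.
(* Injectivity of [f] on [s] allows one to transport the sets [A k] to the image. *)
- move=> A mA; pose A' y := A (nth k0 s (index y [seq f k | k <- s])).
  have mA' y : measurable (A' y) by exact: mA.
  have A'E k : k \in s -> A' (f k) = A k.
    move=> ks; rewrite /A' -[in index _ _](nth_index k0 ks).
    by rewrite -(nth_map k0 (f k0)) ?index_mem// index_uniq ?size_map ?index_mem// nth_index.
  have := iX A' mA'; rewrite /rect !big_map => e.
  transitivity (P (\big[setI/setT]_(k <- s) X (f k) @^-1` A' (f k))).
    by congr (P _); apply: eq_big_seq => k ks; rewrite A'E.
  by rewrite e; apply: eq_big_seq => k ks; rewrite A'E.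
- by move=> k ks; apply: eX; exact: map_f.
Qed.

Lemma expfam_scale (K : eqType) (s : seq K) r (X : K -> T -> R) (c : K -> R) :
  (forall k, 0 < c k) -> expfam P s r X ->
  expfam P s (fun k => r k / c k) (fun k u => c k * X k u).
Proof.
move=> c0 [us mX iX eX]; split=> //.
- by move=> k; exact: measurable_funM.
- move=> A mA; pose A' k := (fun x : R => c k * x) @^-1` A k.
  have mc k : measurable_fun setT (fun x : R => c k * x) by exact: measurable_funM.
  have mA' k : measurable (A' k) by exact: preimage_measurable.
  exact: (iX A' mA').
- move=> k ks t; have -> : [set u | t < c k * X k u] = [set u | t / c k < X k u].
    by apply/seteqP; split => u /=; rewrite ltr_pdivrMr// mulrC.
  rewrite eX//; congr (expR (- _))%:E.
  rewrite -mulrA; congr (_ * _).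
  rewrite -[X in Num.max _ X](mulr0 (c k)^-1) [t / _]mulrC -maxr_pMr ?invr_ge0//; exact: ltW.
Qed.

End expfam_transfer.

(** * Moment generating function of the exponential law *)

Section exponential_law.
Context (R : realType).
Implicit Types (c : R).

Lemma exp_law_of_distribution d (T : measurableType d) (P : probability T R) c (X : T -> R) :
  0 < c -> measurable_fun setT X ->
  (forall A, measurable A -> P (X @^-1` A) = exponential_prob c A) -> exp_law P c X.
Proof.
move=> c0 mX h t.
have neg0 : P (X @^-1` `]-oo, 0[) = 0%E.
  rewrite h//; apply: integral0_eq => x /=; rewrite in_itv/= => x0.
  by rewrite lt0_exponential_pdf.
have le_t (r : R) : 0 <= r -> P (X @^-1` `[0, r]) = (1 - (expR (- (c * r)))%:E)%E.
  rewrite h// le_eqVlt => /predU1P[<-|r0].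
    by rewrite mulr0 oppr0 expR0 subee// set_itv1 /exponential_prob integral_set1.
  by rewrite exponential_prob_itv0c// mulNr.
set r := Num.max t 0.
have r0 : 0 <= r by rewrite /r le_max lexx orbT.
have mS (i : interval R) : measurable (X @^-1` [set` i]) by exact: preimage_measurable.
have Hr : P [set u | r < X u] = (expR (- (c * r)))%:E.
  have -> : [set u | r < X u] = ~` (X @^-1` `]-oo, 0[ `|` X @^-1` `[0, r]).
    apply/seteqP; split => u /=; rewrite !in_itv/=.
      move=> ru [|/andP[_]]; last by rewrite leNgt ru.
      by rewrite ltNge (ltW (le_lt_trans r0 ru)).
    move=> H; rewrite ltNge; apply/negP => Xr; apply: H.
    by case: (ltP (X u) 0) => Xu; [left|right].
  rewrite probability_setC; last exact: measurableU.
  have e : P (X @^-1` `]-oo, 0[ `|` X @^-1` `[0, r]) = (P (X @^-1` `]-oo, 0%R[) + P (X @^-1` `[0%R, r]))%E.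
    apply: measureU => //; apply/seteqP; split => u //= -[]; rewrite !in_itv/=.
    by move=> u0 /andP[]; rewrite leNgt u0.
  by rewrite e neg0 add0e le_t// oppeB// addeA subee// add0e.
have [t0|t0] := leP 0 t; first by move: Hr; rewrite /r max_l.
have mgt s : measurable [set u | s < X u] by exact: measurable_set_gt.
apply/eqP; rewrite -Hr eq_le; apply/andP; split; last first.
  apply: le_measure; rewrite ?inE// => u /=; apply: le_lt_trans.
  by rewrite /r le_max lexx.
by rewrite Hr /r max_r ?(ltW t0)// mulr0 oppr0 expR0 probability_le1.
Qed.

(** Conversely, the tail determines the distribution. *)
Lemma exp_law_distribution d (T : measurableType d) (P : probability T R) c (X : T -> R) :
  0 < c -> measurable_fun setT X -> exp_law P c X ->
  forall A, measurable A -> P (X @^-1` A) = exponential_prob c A.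
Proof.
move=> c0 mX eX.
pose nu := exponential_distribution_exponential_prob__canonical__probability_measure_Probability c0.
have en : exp_law nu c (id : measurableTypeR R -> R).
  by apply: exp_law_of_distribution => // A mA; rewrite preimage_id.
pose m1 : {measure set R -> \bar R} := pushforward P X.
pose m2 : {measure set R -> \bar R} := pushforward nu (id : measurableTypeR R -> R).
move=> A mA; rewrite -[LHS]/(m1 mX A) -[RHS]/(m2 (@measurable_id _ _ _) A).
apply: measure_unique_rays => //.
- by rewrite /m1 /= /pushforward preimage_setT (le_lt_trans (probability_le1 _ _))// ltry.
- by rewrite /m1 /m2 /= /pushforward !preimage_setT !probability_setT.
- have e d' (T' : measurableType d') (V : T' -> R) (t : R) : V @^-1` `]t, +oo[ = [set u | t < V u].
    by apply/seteqP; split => x /=; rewrite in_itv/= andbT.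
  by move=> t; rewrite /m1 /m2 /= /pushforward !e eX en.
Qed.

(** Integration against the exponential law, by means of its density. *)
Lemma integral_exponential_prob c (c0 : 0 < c) (f : R -> \bar R) :
  (forall x, 0 <= f x)%E -> measurable_fun setT f ->
  (\int[exponential_distribution_exponential_prob__canonical__measure_function_Measure c0]_x f x =
   \int[lebesgue_measure]_x (f x * (exponential_pdf c x)%:E))%E.
Proof.
move=> f0 mf.
set nu := exponential_distribution_exponential_prob__canonical__measure_function_FiniteMeasure c0.
have nmu : nu `<< (@lebesgue_measure R).
  apply/null_content_dominatesP => A mA A0.
  by apply: null_set_integral => //; apply/measurable_funTS/measurable_int/(integrable_exponential_pdf c0).
have mpdf : measurable_fun setT (EFin \o exponential_pdf c).
  by apply/measurable_EFinP; exact: measurable_exponential_pdf.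
rewrite -(Radon_Nikodym_SigmaFinite.change_of_variables nmu)//.
have iRN := Radon_Nikodym_SigmaFinite.f_integrable nmu.
apply: ae_eq_integral => //.
- by apply: emeasurable_funM => //; exact: measurable_int iRN.
- exact: emeasurable_funM.
- apply: ae_eqe_mul2l; apply: integral_ae_eq => //.
  by move=> E _ mE; rewrite -(Radon_Nikodym_SigmaFinite.f_integral nmu).
Qed.

Lemma exp_law_mgf d (T : measurableType d) (P : probability T R) c (X : T -> R) th :
  0 < c -> measurable_fun setT X -> exp_law P c X -> th < c ->
  (\int[P]_u (expR (th * X u))%:E = (c / (c - th))%:E)%E.
Proof.
move=> c0 mX eX thc.
pose Y : T -> measurableTypeR R := X.
have mY : measurable_fun setT Y by [].
have mexp : measurable_fun setT (fun x : measurableTypeR R => (expR (th * x))%:E).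
  by apply/measurable_EFinP; apply: measurableT_comp => //; exact: measurable_funM.
transitivity (\int[pushforward P Y]_x (expR (th * x))%:E)%E.
  rewrite (ge0_integral_pushforward mY)// => x _; by rewrite lee_fin expR_ge0.
rewrite (eq_measure_integral (exponential_distribution_exponential_prob__canonical__measure_function_Measure c0)); last first.
  by move=> A mA _; exact: exp_law_distribution.
rewrite integral_exponential_prob//.
have ct : 0 < c - th by rewrite subr_gt0.
rewrite (eq_integral (fun x : measurableTypeR R => (c / (c - th))%:E * (exponential_pdf (c - th) x)%:E)%E); last first.
  move=> x _; rewrite -!EFinM; congr EFin.
  have [x0|x0] := ltP x 0; first by rewrite !lt0_exponential_pdf// !mulr0.
  rewrite !exponential_pdfE// [RHS]mulrA divfK ?gt_eqF// mulrCA -expRD; congr (_ * expR _); ring.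
rewrite ge0_integralZl//.
- by rewrite integral_exponential_pdf// mule1.
- by apply/measurable_EFinP; exact: measurable_exponential_pdf.
- by move=> x _; rewrite lee_fin exponential_pdf_ge0// ltW.
- by rewrite lee_fin divr_ge0// ltW.
Qed.

End exponential_law.

(** * Sums of independent variables *)

Section sums.
Context d (T : measurableType d) (R : realType) (P : probability T R).

(** The moment generating function of a sum of two independent variables, by Fubini's theorem. *)
Lemma mgf_add (S Z : T -> R) th : measurable_fun setT S -> measurable_fun setT Z ->
  (forall A B, measurable A -> measurable B ->
    P (S @^-1` A `&` Z @^-1` B) = (P (S @^-1` A) * P (Z @^-1` B))%E) ->
  (\int[P]_u (expR (th * (S u + Z u)))%:E =
   \int[P]_u (expR (th * S u))%:E * \int[P]_u (expR (th * Z u))%:E)%E.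
Proof.
move=> mS mZ ind.
pose S' : {mfun T >-> R} := HB.pack S (isMeasurableFun.Build _ _ _ _ _ mS).
pose Z' : {mfun T >-> R} := HB.pack Z (isMeasurableFun.Build _ _ _ _ _ mZ).
have mSZ : measurable_fun setT (fun u => (S u, Z u)) by exact: measurable_fun_pair.
pose m : {measure set (R * R) -> \bar R} := pushforward P (fun u => (S u, Z u)).
pose f (x : R) : \bar R := (expR (th * x))%:E.
have mf : measurable_fun setT f.
  by apply/measurable_EFinP; apply: measurableT_comp => //; exact: measurable_funM.
have f0 x : (0 <= f x)%E by rewrite lee_fin expR_ge0.
pose F (p : R * R) := (f p.1 * f p.2)%E.
have mF : measurable_fun setT F.
  by apply: emeasurable_funM; apply: measurableT_comp.
have F0 p : (0 <= F p)%E by rewrite mule_ge0.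
transitivity (\int[m mSZ]_p F p)%E.
  rewrite (ge0_integral_pushforward mSZ)// preimage_setT; apply: eq_integral => u _.
  by rewrite /F /f /= -EFinM -expRD mulrDr.
rewrite (eq_measure_integral (distribution P S' \x distribution P Z')%E); last first.
  move=> A mA _; apply/esym; exact: product_measure_unique.
rewrite fubini_tonelli1//; rewrite /fubini_F /F /=.
have Ef (V : T -> R) (V' : {mfun T >-> R}) : V' = V :> (T -> R) ->
    (\int[distribution P V']_x f x = \int[P]_u (expR (th * V u))%:E)%E.
  by move=> <-; rewrite ge0_integral_distribution.
under eq_integral do rewrite ge0_integralZl//.
rewrite ge0_integralZr//; last by apply: integral_ge0.
by rewrite (Ef S)// (Ef Z).
Qed.

Context (K : eqType).
Implicit Types (s : seq K) (X : K -> T -> R) (A : K -> set R) (r : K -> R).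

Lemma measurable_sum_seq s X : (forall k, measurable_fun setT (X k)) ->
  measurable_fun setT (fun u => \sum_(k <- s) X k u).
Proof.
move=> mX; elim: s => [|k s IH].
  by rewrite (_ : (fun u => _) = cst 0)//; apply/funext => u; rewrite big_nil.
rewrite (_ : (fun u => _) = (fun u => X k u + \sum_(k <- s) X k u)).
  exact: measurable_funD.
by apply/funext => u; rewrite big_cons.
Qed.

(** The sum of a subfamily is independent of the remaining variables. *)
Lemma indep_sum s1 s2 r X B A : expfam P (s1 ++ s2) r X -> measurable B ->
  (forall k, measurable (A k)) ->
  P ((fun u => \sum_(k <- s1) X k u)%R @^-1` B `&` rect s2 X A) =
  (P ((fun u => \sum_(k <- s1) X k u)%R @^-1` B) * P (rect s2 X A))%E.
Proof.
elim: s1 s2 B A => [|k s1 IH] s2 B A fX mB mA.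
  have -> : (fun u => \sum_(k <- [::]) X k u)%R @^-1` B =
      if asbool (B 0) then setT else set0.
    by apply/seteqP; split => u /=; rewrite big_nil; case: asboolP.
  case: asboolP => _; first by rewrite setTI probability_setT mul1e.
  by rewrite set0I measure0 mul0e.
have [us mX _ _] := fX.
have fX1 : expfam P (s1 ++ (k :: s2)) r X.
  apply: expfam_perm fX; by rewrite -[k :: s2]cat1s perm_sym perm_catCA.
have fX2 : expfam P (s1 ++ [:: k]) r X.
  by apply: (@expfam_cat _ _ _ _ _ _ s2); rewrite -catA.
have fXk : expfam P (k :: s2) r X.
  have [us1 _ _ _] := fX1; apply: expfam_sub fX1; first by move: us1; rewrite cat_uniq => /and3P[].
  by move=> y ys; rewrite mem_cat ys orbT.
have fs2 : expfam P s2 r X.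
  have [/= /andP[_ us2] _ _ _] := fXk.
  by apply: expfam_sub fXk => // y ys; rewrite inE ys orbT.
have mE := measurable_rect s2 mX mA.
have [c cE] := probability_nneg_num P mE.
have mD : measurable [set p : R * R | B (p.1 + p.2)].
  rewrite -[X in measurable X]setTI.
  by apply: (measurable_funD measurable_fst measurable_snd).
pose S u := \sum_(k <- s1) X k u.
have mS : measurable_fun setT S by exact: measurable_sum_seq.
have := @pair_law_unique _ _ _ P _ _ R R (X k) (X k) S S (rect s2 X A) setT c.
move=> /(_ (mX k) (mX k) mS mS mE measurableT _ _ mD).
rewrite setIT.
have -> : (fun t => (X k t, S t)) @^-1` [set p | B (p.1 + p.2)] =
  (fun u => \sum_(k0 <- (k :: s1)) X k0 u) @^-1` B.
  by apply/seteqP; split => u /=; rewrite big_cons.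
move=> ->; first by rewrite -cE muleC.
move=> A1 A2 mA1 mA2; rewrite setIT -cE.
pose A' y := if y == k then A1 else A y.
have mA' y : measurable (A' y) by rewrite /A'; case: ifP.
have kA' : A' k = A1 by rewrite /A' eqxx.
have kN : k \notin s2.
  by move: us => /= /andP[]; rewrite mem_cat negb_or => /andP[].
have sA' : rect s2 X A' = rect s2 X A.
  apply: eq_rect => y ys; rewrite /A' ifF//; apply/negP => /eqP yk.
  by move: kN; rewrite -yk ys.
have := IH _ _ _ fX1 mA2 mA'; have := IH _ _ _ fX2 mA2 mA'.
rewrite !rect_cons kA' sA' [rect [::] _ _]big_nil setIT => e1 e2.
have e3 : P (X k @^-1` A1 `&` rect s2 X A) = (P (X k @^-1` A1) * P (rect s2 X A))%E.
  have [_ _ iX _] := fXk; have := iX _ mA'; rewrite rect_cons big_cons kA' sA' => ->.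
  congr (_ * _)%E; have [_ _ iX2 _] := fs2; by rewrite -(iX2 _ mA') sA'.
rewrite (setIC (X k @^-1` A1)) e1 -setIA e2 e3.
by rewrite [RHS]muleC muleA.
Qed.

End sums.

(** * Chernoff bounds for sums of exponential variables *)

Section chernoff_bounds.
Context d (T : measurableType d) (R : realType) (P : probability T R).
Context (K : eqType).
Implicit Types (s : seq K) (X : K -> T -> R) (r : K -> R).

Lemma inv_onem_le_exp (x : R) : `|x| <= 2^-1 -> (1 - x)^-1 <= expR (x + 2 * x ^+ 2).
Proof.
rewrite ler_norml => /andP[x1 x2].
have h : 0 < 1 - x by lra.
rewrite -[leLHS]mul1r ler_pdivrMr//.
apply: (@le_trans _ _ ((1 + (x + 2 * x ^+ 2)) * (1 - x))); last first.
  by rewrite ler_pM2r// expR_ge1Dx.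
have : 0 <= x ^+ 2 * (1 - 2 * x) by rewrite mulr_ge0 ?sqr_ge0//; lra.
have -> : (1 + (x + 2 * x ^+ 2)) * (1 - x) = 1 + x ^+ 2 * (1 - 2 * x) by ring.
lra.
Qed.

Lemma mgf_sum s r X (c sg : R) : 0 < c -> `|sg| <= 2^-1 -> expfam P s r X ->
  (forall k, k \in s -> r k = c) ->
  (\int[P]_u (expR (sg * c * (\sum_(k <- s) X k u)))%:E <=
   (expR ((size s)%:R * (sg + 2 * sg ^+ 2)))%:E)%E.
Proof.
move=> c0 sg2; elim: s => [|k s IH] fX rc.
  rewrite mul0r expR0 (eq_integral (cst 1%E)); last first.
    by move=> u _; rewrite big_nil mulr0 expR0.
  by rewrite integral_cst//= probability_setT mul1e.
have [/= /andP[ks us] mX _ eX] := fX.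
have fs : expfam P s r X.
  by apply: expfam_sub fX => // y ys; rewrite inE ys orbT.
have fX' : expfam P (s ++ [:: k]) r X.
  by apply: expfam_perm fX; rewrite -[k :: s]cat1s perm_catC.
rewrite (eq_integral (fun u => (expR (sg * c * ((\sum_(k <- s) X k u) + X k u)))%:E)); last first.
  by move=> u _; rewrite big_cons addrC.
have fk : expfam P [:: k] r X.
  by apply: expfam_sub fX => // y; rewrite !inE => ->.
rewrite (@mgf_add _ _ _ P (fun u => \sum_(k <- s) X k u) (X k))//; last 2 first.
- exact: measurable_sum_seq.
- move=> A B mA mB.
  have := @indep_sum _ _ _ P _ s [:: k] r X A (fun=> B) fX' mA (fun=> mB).
  by rewrite rect_cons [rect [::] _ _]big_nil setIT.
(* Each factor is [c / (c - sg * c)], that is [(1 - sg)^-1]. *)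
have ck : sg * c < c.
  rewrite gtr_pMl// (le_lt_trans (ler_norm _))// (le_lt_trans sg2)//; lra.
have eXk : exp_law P c (X k) by rewrite -(rc k) ?mem_head//; apply: eX; exact: mem_head.
rewrite (exp_law_mgf c0 (mX k) eXk ck).
have -> : c / (c - sg * c) = (1 - sg)^-1.
  rewrite (_ : c - sg * c = c * (1 - sg)); last by ring.
  by rewrite invfM mulrA divff ?mul1r// gt_eqF.
have sg1 : 0 < 1 - sg.
  by rewrite subr_gt0 (le_lt_trans (ler_norm _))// (le_lt_trans sg2)//; lra.
apply: (@le_trans _ _ ((expR ((size s)%:R * (sg + 2 * sg ^+ 2)))%:E * (expR (sg + 2 * sg ^+ 2))%:E)%E).
  apply: lee_pmul.
  - by apply: integral_ge0 => u _; rewrite lee_fin expR_ge0.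
  - by rewrite lee_fin invr_ge0 ltW.
  - by apply: IH => // y ys; apply: rc; rewrite inE ys orbT.
  - by rewrite lee_fin inv_onem_le_exp.
rewrite -EFinM -expRD lee_fin ler_expR.
rewrite /= -[(size s).+1%:R]natr1; lra.
Qed.

(** Chernoff's inequality; [th] may be negative. *)
Lemma markov_exp (S : T -> R) (th a M : R) : measurable_fun setT S ->
  (\int[P]_u (expR (th * S u))%:E <= (expR M)%:E)%E ->
  (P [set u | (a <= th * S u)%R] <= (expR (M - a))%:E)%E.
Proof.
move=> mS hM.
have mS' : measurable_fun setT (fun u => th * S u) by exact: measurable_funM.
pose S' : {RV P >-> R} := HB.pack (fun u => th * S u) (isMeasurableFun.Build _ _ _ _ _ mS').
have := @chernoff _ _ _ P S' 1 a ltr01; rewrite mul1r => /le_trans; apply.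
rewrite expRD EFinM; apply: lee_wpmul2r; first by rewrite lee_fin expR_ge0.
rewrite (le_trans _ hM)// /mmt_gen_fun unlock.
by under eq_integral do rewrite /= mulr1.
Qed.

Lemma sum_exp_upper s r X (c sg t : R) : 0 < c -> 0 < sg -> sg <= 2^-1 ->
  expfam P s r X -> (forall k, k \in s -> r k = c) ->
  (P [set u | ((size s)%:R / c + t <= \sum_(k <- s) X k u)%R] <=
   (expR (2 * (size s)%:R * sg ^+ 2 - sg * c * t))%:E)%E.
Proof.
move=> c0 sg0 sg2 fX rc; have [_ mX _ _] := fX.
have sgn : `|sg| <= 2^-1 by rewrite gtr0_norm.
have h := mgf_sum c0 sgn fX rc.
have := @markov_exp _ _ (sg * c * ((size s)%:R / c + t)) _ (measurable_sum_seq s mX) h.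
have -> : (size s)%:R * (sg + 2 * sg ^+ 2) - sg * c * ((size s)%:R / c + t) =
  2 * (size s)%:R * sg ^+ 2 - sg * c * t by field; rewrite gt_eqF.
apply: le_trans; rewrite le_eqVlt; apply/orP; left; apply/eqP; congr (P _).
by apply/seteqP; split => u /=; rewrite ler_pM2l ?mulr_gt0.
Qed.

Lemma sum_exp_lower s r X (c sg t : R) : 0 < c -> 0 < sg -> sg <= 2^-1 ->
  expfam P s r X -> (forall k, k \in s -> r k = c) ->
  (P [set u | (\sum_(k <- s) X k u <= (size s)%:R / c - t)%R] <=
   (expR (2 * (size s)%:R * sg ^+ 2 - sg * c * t))%:E)%E.
Proof.
move=> c0 sg0 sg2 fX rc; have [_ mX _ _] := fX.
have sgn : `|- sg| <= 2^-1 by rewrite normrN gtr0_norm.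
have h := mgf_sum c0 sgn fX rc.
have := @markov_exp _ _ (- sg * c * ((size s)%:R / c - t)) _ (measurable_sum_seq s mX) h.
have -> : (size s)%:R * (- sg + 2 * (- sg) ^+ 2) - - sg * c * ((size s)%:R / c - t) =
  2 * (size s)%:R * sg ^+ 2 - sg * c * t by field; rewrite gt_eqF.
apply: le_trans; rewrite le_eqVlt; apply/orP; left; apply/eqP; congr (P _).
have h0 : - sg * c < 0 by rewrite mulNr oppr_lt0 mulr_gt0.
by apply/seteqP; split => u /=; rewrite ler_nM2l.
Qed.

(** Both tails, with a rate [kp] that is uniform over all families of at most [C * N]
    variables. *)
Lemma sum_exp_deviation (c C dl : R) : 0 < c -> 0 < C -> 0 < dl ->
  exists2 kp : R, 0 < kp & forall (N : nat) s r X,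
    expfam P s r X -> (forall k, k \in s -> r k = c) ->
    (size s)%:R <= C * N%:R ->
    (P [set u | ((size s)%:R / c + dl * N%:R <= \sum_(k <- s) X k u)%R] <=
      (expR (- (kp * N%:R)))%:E)%E /\
    (P [set u | (\sum_(k <- s) X k u <= (size s)%:R / c - dl * N%:R)%R] <=
      (expR (- (kp * N%:R)))%:E)%E.
Proof.
move=> c0 C0 dl0.
(* With this [sg], the quadratic term of the exponent is at most half of the linear one. *)
pose sg := Num.min 2^-1 (c * dl / (4 * C)).
have sg0 : 0 < sg by rewrite lt_min invr_gt0 ltr0n/= divr_gt0// mulr_gt0.
have sg2 : sg <= 2^-1 by rewrite ge_min lexx.
have sgC : sg * C <= c * dl / 4.
  rewrite -ler_pdivlMr// (_ : c * dl / 4 / C = c * dl / (4 * C)).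
    by rewrite ge_min lexx orbT.
  by field; rewrite gt_eqF.
exists (sg * c * dl / 2); first by rewrite divr_gt0// !mulr_gt0.
move=> N s r X fX rc sN.
have h : 2 * (size s)%:R * sg ^+ 2 - sg * c * (dl * N%:R) <= - (sg * c * dl / 2 * N%:R).
  have h1 : 2 * (size s)%:R * sg ^+ 2 <= 2 * (C * N%:R) * sg ^+ 2.
    by rewrite ler_wpM2r ?sqr_ge0// ler_wpM2l.
  have h2 : (sg * C) * (2 * sg * N%:R) <= c * dl / 4 * (2 * sg * N%:R).
    by rewrite ler_wpM2r// !mulr_ge0// ltW.
  lra.
by split; [apply: le_trans (sum_exp_upper (dl * N%:R) c0 sg0 sg2 fX rc) _
  |apply: le_trans (sum_exp_lower (dl * N%:R) c0 sg0 sg2 fX rc) _];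
  rewrite lee_fin ler_expR.
Qed.

End chernoff_bounds.

(** * Last passage values by recursion *)

Section lpp_recursion.
Context (R : realType).
Implicit Types (w v : nat * nat -> R) (i j n m p q : nat).

(** The last passage value from [(0, 0)] to [(i, j)], by the recursion on the last step. *)
Fixpoint lpp w i : nat -> R :=
  fix lpp_i j := match i, j with
    | 0, 0 => w (0, 0)%N
    | i'.+1, 0 => lpp w i' 0%N + w (i, 0%N)
    | 0, j'.+1 => lpp_i j' + w (0%N, j)
    | i'.+1, j'.+1 => Num.max (lpp w i' j) (lpp_i j') + w (i, j)
    end.

Lemma lpp00 w : lpp w 0 0 = w (0, 0)%N. Proof. by []. Qed.
Lemma lppS0 w i : lpp w i.+1 0 = lpp w i 0 + w (i.+1, 0%N). Proof. by []. Qed.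
Lemma lpp0S w j : lpp w 0 j.+1 = lpp w 0 j + w (0%N, j.+1). Proof. by []. Qed.
Lemma lppSS w i j :
  lpp w i.+1 j.+1 = Num.max (lpp w i j.+1) (lpp w i.+1 j) + w (i.+1, j.+1).
Proof. by []. Qed.

(** The weights seen from the lattice point [(p, q)]. *)
Definition wshift p q w : nat * nat -> R := fun y => w (y.1 + p, y.2 + q)%N.

Lemma lpp_right w i j : lpp w i j + w (i.+1, j) <= lpp w i.+1 j.
Proof. by case: j => [|j]; rewrite ?lppS0// lppSS lerD2r le_max lexx. Qed.

Lemma lpp_up w i j : lpp w i j + w (i, j.+1) <= lpp w i j.+1.
Proof. by case: i => [|i]; rewrite ?lpp0S// lppSS lerD2r le_max lexx orbT. Qed.

Lemma eq_lpp w v n m : (forall y, w y = v y) -> lpp w n m = lpp v n m.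
Proof. by move=> wv; congr (lpp _ n m); exact/funext. Qed.

Lemma lpp_ge0 w n m : (forall y, 0 <= w y) -> 0 <= lpp w n m.
Proof.
move=> w0; elim: n m => [|n IHn]; elim=> [|m IHm] //=.
- by rewrite addr_ge0.
- by rewrite addr_ge0.
- by rewrite addr_ge0// le_max IHn.
Qed.

Lemma weight_le_lpp w n m : (forall y, 0 <= w y) -> w (n, m) <= lpp w n m.
Proof.
move=> w0; case: n m => [|n] [|m] //.
- by rewrite lpp0S lerDr lpp_ge0.
- by rewrite lppS0 lerDr lpp_ge0.
- by apply: le_trans (lpp_right _ _ _); rewrite lerDr lpp_ge0.
Qed.

(** With nonnegative weights, starting closer to the end point decreases the value. *)
Lemma lpp_shift_le w p q n m : (forall y, 0 <= w y) ->
  lpp (wshift p q w) n m <= lpp w (n + p)%N (m + q)%N.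
Proof.
move=> w0; have w_le := fun i j => weight_le_lpp i j w0.
elim: n m => [|n IHn] m.
  elim: m => [|m IHm]; first by rewrite lpp00 /wshift /= !add0n; exact: w_le.
  rewrite lpp0S addSn; apply: le_trans (lpp_up _ _ _).
  by rewrite {2}/wshift /= addSn lerD2r.
elim: m => [|m IHm].
  rewrite lppS0 addSn; apply: le_trans (lpp_right _ _ _).
  by rewrite {2}/wshift /= addSn lerD2r IHn.
have e : wshift p q w (n.+1, m.+1) = w ((n + p).+1, (m + q).+1) by [].
rewrite !addSn !lppSS e lerD2r ge_max !le_max.
by have := IHn m.+1; rewrite addSn => ->; move: IHm; rewrite addSn => ->; rewrite orbT.
Qed.

(** Decomposition of a path at the point where it leaves the axes. *)
Lemma lpp_exit w n m :
  (exists2 k, (k <= n)%N & lpp w n.+1 m.+1 <=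
      lpp w k.+1 0 + lpp (wshift k.+1 1 w) (n - k)%N m) \/
  (exists2 k, (k <= m)%N & lpp w n.+1 m.+1 <=
      lpp w 0 k.+1 + lpp (wshift 1 k.+1 w) n (m - k)%N).
Proof.
have wR k i j : (k <= i)%N -> lpp (wshift k.+1 1 w) (i - k) j + w (i.+2, j.+1) <=
    lpp (wshift k.+1 1 w) (i.+1 - k) j.
  move=> ki; rewrite subSn//; apply: le_trans (lpp_right _ _ _).
  by rewrite {3}/wshift/= addn1 addSn addnS subnK.
have wR' k i j : (k <= j)%N -> lpp (wshift 1 k.+1 w) i (j - k) + w (i.+2, j.+1) <=
    lpp (wshift 1 k.+1 w) i.+1 (j - k).
  move=> ki; apply: le_trans (lpp_right _ _ _).
  by rewrite {3}/wshift/= addn1 addnS subnK.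
have wU k i j : (k <= i)%N -> lpp (wshift k.+1 1 w) (i - k) j + w (i.+1, j.+2) <=
    lpp (wshift k.+1 1 w) (i - k) j.+1.
  move=> ki; apply: le_trans (lpp_up _ _ _).
  by rewrite {3}/wshift/= addn1 addnS subnK.
have wU' k i j : (k <= j)%N -> lpp (wshift 1 k.+1 w) i (j - k) + w (i.+1, j.+2) <=
    lpp (wshift 1 k.+1 w) i (j.+1 - k).
  move=> ki; rewrite subSn//; apply: le_trans (lpp_up _ _ _).
  by rewrite {3}/wshift/= addn1 addSn addnS subnK.
have E n' m' : lpp w n'.+1 m'.+1 = lpp w n' m'.+1 + w (n'.+1, m'.+1) \/
    lpp w n'.+1 m'.+1 = lpp w n'.+1 m' + w (n'.+1, m'.+1).
  by rewrite lppSS; case: (leP (lpp w n' m'.+1) (lpp w n'.+1 m')); [right|left].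
elim: n m => [|n IHn] m.
  elim: m => [|m IHm].
    by have [->|->] := E 0%N 0%N; [right|left]; exists 0%N.
  have [->|->] := E 0%N m.+1.
  - by right; exists m.+1 => //; rewrite subnn.
  - case: IHm => -[k kn IH]; [left|right]; exists k => //.
    + by rewrite (le_trans _ (lerD (lexx _) (wU _ _ _ kn)))// addrA lerD2r.
    + exact: leqW.
    + by rewrite (le_trans _ (lerD (lexx _) (wU' _ _ _ kn)))// addrA lerD2r.
elim: m => [|m IHm]; [have [->|->] := E n.+1 0%N|have [->|->] := E n.+1 m.+1].
- case: (IHn 0%N) => -[k kn IH]; [left|right]; exists k => //.
  + exact: leqW.
  + by rewrite (le_trans _ (lerD (lexx _) (wR _ _ _ kn)))// addrA lerD2r.
  + by rewrite (le_trans _ (lerD (lexx _) (wR' _ _ _ kn)))// addrA lerD2r.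
- by left; exists n.+1 => //; rewrite subnn.
- case: (IHn m.+1) => -[k kn IH]; [left|right]; exists k => //.
  + exact: leqW.
  + by rewrite (le_trans _ (lerD (lexx _) (wR _ _ _ kn)))// addrA lerD2r.
  + by rewrite (le_trans _ (lerD (lexx _) (wR' _ _ _ kn)))// addrA lerD2r.
- case: IHm => -[k kn IH]; [left|right]; exists k => //.
  + by rewrite (le_trans _ (lerD (lexx _) (wU _ _ _ kn)))// addrA lerD2r.
  + exact: leqW.
  + by rewrite (le_trans _ (lerD (lexx _) (wU' _ _ _ kn)))// addrA lerD2r.
Qed.

(** Horizontal and vertical increments of [lpp w]. *)
Definition hinc w i j := lpp w i j - lpp w i.-1 j.
Definition vinc w i j := lpp w i j - lpp w i j.-1.

(** The increments across a cell are obtained by the map of [burke_joint]. *)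
Lemma hinc_rec w i j : hinc w i.+1 j.+1 =
  w (i.+1, j.+1) + Num.max (hinc w i.+1 j - vinc w i j.+1) 0.
Proof.
rewrite /hinc /vinc lppSS !succnK.
by case: (leP (lpp w i j.+1) (lpp w i.+1 j)) => h; [rewrite max_l|rewrite max_r]; lra.
Qed.

Lemma vinc_rec w i j : vinc w i.+1 j.+1 =
  w (i.+1, j.+1) + Num.max (vinc w i j.+1 - hinc w i.+1 j) 0.
Proof.
rewrite /hinc /vinc lppSS !succnK.
by case: (leP (lpp w i j.+1) (lpp w i.+1 j)) => h; [rewrite max_r|rewrite max_l]; lra.
Qed.

Lemma lpp_hinc_sum w n m : lpp w n m = lpp w 0 m + \sum_(k <- iota 1 n) hinc w k m.
Proof.
elim: n => [|n IH]; first by rewrite big_nil addr0.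
by rewrite -addn1 iotaD big_cat /= big_seq1 addrA -IH /hinc add1n/= addn1 addrCA subrr addr0.
Qed.

Lemma lpp_left_sum w m : lpp w 0 m = w (0, 0)%N + \sum_(k <- iota 1 m) w (0%N, k).
Proof.
elim: m => [|m IH]; first by rewrite big_nil addr0.
by rewrite -addn1 iotaD big_cat /= big_seq1 addrA -IH add1n addn1.
Qed.

Lemma lpp_bottom_sum w n : lpp w n 0 = w (0, 0)%N + \sum_(k <- iota 1 n) w (k, 0%N).
Proof.
elim: n => [|n IH]; first by rewrite big_nil addr0.
by rewrite -addn1 iotaD big_cat /= big_seq1 addrA -IH add1n addn1.
Qed.

(** The end point of a path from [(1, 1)] has positive coordinates, and its weight is at
    most the last passage value. *)
Lemma path_sum_le_lpp w (s : seq (nat * nat)) : head (0, 0)%N s = (1, 1)%N -> s != [::] ->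
  sorted oriented_step s ->
  exists n m, last (0, 0)%N s = (n.+1, m.+1) /\ \sum_(y <- s) w y <= lpp (wshift 1 1 w) n m.
Proof.
elim/last_ind: s => // q y IH.
case/lastP: q IH => [|q z] IH.
  by move=> /= -> _ _; exists 0%N, 0%N; rewrite big_seq1.
move=> hd _ so.
have hd' : head (0, 0)%N (rcons q z) = (1, 1)%N by move: hd; case: (q).
have so' : sorted oriented_step (rcons q z).
  by move: so; case: (q) => //= a q'; rewrite rcons_path => /andP[].
have st : oriented_step z y.
  by move: so; case: (q) => [|a q'] /=; rewrite ?andbT// rcons_path last_rcons => /andP[].
have [n [m [la le]]] : exists n m, last (0, 0)%N (rcons q z) = (n.+1, m.+1) /\
    \sum_(y <- rcons q z) w y <= lpp (wshift 1 1 w) n m.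
  by apply: IH => //; case: (q).
have zE : z = (n.+1, m.+1) by rewrite last_rcons in la.
rewrite last_rcons -[X in bigop.body _ X _]cats1 big_cat /= big_seq1.
move: st le; rewrite zE => /orP[] /eqP -> /= le.
  exists n.+1, m; split => //; apply: le_trans (lpp_right _ _ _).
  by rewrite lerD// /wshift /= !addn1.
exists n, m.+1; split => //; apply: le_trans (lpp_up _ _ _).
by rewrite lerD// /wshift /= !addn1.
Qed.

Lemma lpp_path w n m : exists2 p, oriented_path n.+1 m.+1 p &
  \sum_(y <- p) w y = lpp (wshift 1 1 w) n m.
Proof.
have add_pt n1 m1 n2 m2 (p : seq (nat * nat)) : oriented_path n1.+1 m1.+1 p ->
    (n2, m2) = (n1.+1, m1) \/ (n2, m2) = (n1, m1.+1) ->
    oriented_path n2.+1 m2.+1 (rcons p (n2.+1, m2.+1)).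
  move=> [sp hp lp op] h; split.
  - by rewrite size_rcons sp; case: h => -[-> ->]; rewrite !addSn !addnS !subn1.
  - by move: hp; case: (p) lp.
  - by rewrite last_rcons.
  - move: lp op; case: (p) hp => //= a q -> lp op.
    rewrite rcons_path op lp /oriented_step /=.
    by case: h => -[-> ->]; rewrite eqxx ?orbT.
elim: n m => [|n IHn]; elim=> [|m IHm].
- exists [:: (1, 1)%N]; first by split.
  by rewrite big_seq1.
- have [p pp pE] := IHm.
  exists (rcons p (1, m.+2)%N); first by apply: add_pt pp _; right.
  by rewrite -cats1 big_cat big_seq1 pE /= /wshift /= !addn1.
- have [p pp pE] := IHn 0%N.
  exists (rcons p (n.+2, 1)%N); first by apply: add_pt pp _; left.
  by rewrite -cats1 big_cat big_seq1 pE /= /wshift /= !addn1.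
- rewrite lppSS; case: (leP (lpp (wshift 1 1 w) n m.+1) (lpp (wshift 1 1 w) n.+1 m)) => h.
    have [p pp pE] := IHm.
    exists (rcons p (n.+2, m.+2)%N); first by apply: add_pt pp _; right.
    by rewrite -cats1 big_cat big_seq1 pE /= /wshift /= !addn1.
  have [p pp pE] := IHn m.+1.
  exists (rcons p (n.+2, m.+2)%N); first by apply: add_pt pp _; left.
  by rewrite -cats1 big_cat big_seq1 pE /= /wshift /= !addn1.
Qed.

(** [lpp] starts at the origin and the lattice of [last_passage] at [(1, 1)], whence the
    shift. *)
Lemma last_passage_lpp w n m : last_passage w n.+1 m.+1 = lpp (wshift 1 1 w) n m.
Proof.
have [[p [sp hp lp op] lpE] mx] := last_passage_max w (ltn0Sn n) (ltn0Sn m).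
have [q qq qE] := lpp_path w n m.
apply/eqP; rewrite eq_le -{2}qE mx// andbT lpE.
have pn : p != [::] by case: (p) hp.
have [n' [m' [la le]]] := path_sum_le_lpp w hp pn op.
by move: la; rewrite lp => -[-> ->].
Qed.

End lpp_recursion.

(** * Sweeping a box: the increments along its top row *)

Section sweep.
Context d (T : measurableType d) (R : realType) (P : probability T R).
Implicit Types (X : nat * nat -> T -> R) (n m i j : nat).

(** The realization of the weights at the sample point [u]. *)
Definition weights X (u : T) : nat * nat -> R := fun y => X y u.

Lemma measurable_lpp X p q n m : (forall y, measurable_fun setT (X y)) ->
  measurable_fun setT (fun u => lpp (wshift p q (weights X u)) n m).
Proof.
move=> mX; elim: n m => [|n IHn]; elim=> [|m IHm] /=; first exact: mX.
- by apply: measurable_funD => //; exact: mX.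
- by apply: measurable_funD => //; exact: mX.
- by apply: measurable_funD; [apply: measurable_maxr|exact: mX].
Qed.

Lemma wshift0 (w : nat * nat -> R) : wshift 0 0 w = w.
Proof. by apply/funext => -[i j]; rewrite /wshift /= !addn0. Qed.

Lemma measurable_lpp0 X n m : (forall y, measurable_fun setT (X y)) ->
  measurable_fun setT (fun u => lpp (weights X u) n m).
Proof.
move=> mX; rewrite (_ : (fun u => _) = (fun u => lpp (wshift 0 0 (weights X u)) n m)).
  exact: measurable_lpp.
by apply/funext => u; rewrite wshift0.
Qed.

(** The points of the rectangle [{0, ..., n} * {0, ..., m}] other than the origin. *)
Definition box n m : seq (nat * nat) :=
  [seq y <- allpairs pair (iota 0 n.+1) (iota 0 m.+1) | y != (0, 0)%N].

Lemma box_uniq n m : uniq (box n m).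
Proof.
by rewrite filter_uniq// allpairs_uniq ?iota_uniq// => -[? ?] [? ?].
Qed.

Lemma mem_box n m y : (y \in box n m) = [&& y != (0, 0)%N, (y.1 <= n)%N & (y.2 <= m)%N].
Proof.
rewrite mem_filter; congr (_ && _); case: y => y1 y2.
apply/allpairsP/andP => [[[z1 z2] [h1 h2 [-> ->]]]|[h1 h2]].
  by move: h1 h2; rewrite !mem_iota !add0n !ltnS.
by exists (y1, y2); rewrite !mem_iota !add0n !ltnS.
Qed.

(** The family obtained from [X] after processing the rows 1 to [j] of the box, and then the
    cells 1 to [i] of the row [j.+1].  The index [(k, 0)] carries the current horizontal
    increment in the column [k], the index [(0, l)] the current vertical increment in the
    row [l], and the index of a processed cell the minimum of its two incoming increments. *)
Definition sweep X n j i (y : nat * nat) (u : T) : R :=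
  let w := weights X u in
  if y.2 == 0%N then hinc w y.1 (if (y.1 <= i)%N then j.+1 else j)
  else if y.1 == 0%N then
    vinc w (if (y.2 <= j)%N then n else if y.2 == j.+1 then i else 0%N) y.2
  else if (y.2 <= j)%N || ((y.2 == j.+1) && (y.1 <= i)%N) then
    Num.min (hinc w y.1 y.2.-1) (vinc w y.1.-1 y.2)
  else X y u.

Lemma sweep_step X n j i :
  sweep X n j i.+1 = burke_update (i.+1, 0)%N (0, j.+1)%N (i.+1, j.+1) (sweep X n j i).
Proof.
have si : sweep X n j i (i.+1, 0)%N = fun u => hinc (weights X u) i.+1 j.
  by apply/funext => u; rewrite /sweep /= ltnn.
have sj : sweep X n j i (0, j.+1)%N = fun u => vinc (weights X u) i j.+1.
  by apply/funext => u; rewrite /sweep /= ltnn eqxx.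
have sk : sweep X n j i (i.+1, j.+1) = X (i.+1, j.+1).
  by apply/funext => u; rewrite /sweep /= !ltnn andbF.
apply/funext => -[y1 y2]; rewrite /burke_update si sj sk !xpair_eqE.
case: y2 => [|y2]; apply/funext => u.
  rewrite andbT; case: (eqVneq y1 i.+1) => [->|ne] /=.
    by rewrite /sweep /= leqnn hinc_rec.
  rewrite !andbF /=; rewrite /sweep /=.
  by rewrite [(y1 <= i.+1)%N]leq_eqVlt (negbTE ne) /= ltnS.
rewrite andbF; case: y1 => [|y1] /=.
  rewrite eqSS; case: (eqVneq y2 j) => [->|ne] /=.
    by rewrite /sweep /= ltnn eqxx vinc_rec.
  by rewrite /sweep /= eqSS (negbTE ne).
rewrite !eqSS; case: (eqVneq y2 j) => [->|ne] /=; last first.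
  by rewrite andbF /sweep /= eqSS (negbTE ne).
rewrite andbT; case: (eqVneq y1 i) => [->|ne1] /=.
  by rewrite /sweep /= leqnn eqxx orbT.
by rewrite /sweep /= eqxx !ltnn /= [(y1 < i.+1)%N]ltnS leq_eqVlt (negbTE ne1).
Qed.

(** Rates of the stationary model: [a] on the horizontal axis, [b] on the vertical axis,
    [a + b] in the interior. *)
Definition burke_rate (a b : R) (y : nat * nat) : R :=
  if y.2 == 0%N then a else if y.1 == 0%N then b else a + b.

Lemma measurable_sweep X n j i y : (forall y, measurable_fun setT (X y)) ->
  measurable_fun setT (sweep X n j i y).
Proof.
move=> mX; rewrite /sweep.
case: (y.2 == 0%N).
  by apply: measurable_funB; exact: measurable_lpp0.
case: (y.1 == 0%N).
  by apply: measurable_funB; exact: measurable_lpp0.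
case: (_ || _) => //.
by apply: measurable_minr; apply: measurable_funB; exact: measurable_lpp0.
Qed.

Lemma expfam_sweep X a b n m j : (j <= m)%N ->
  expfam P (box n m) (burke_rate a b) X ->
  expfam P (box n m) (burke_rate a b) (sweep X n j 0).
Proof.
move=> jm fX; have [_ mX _ _] := fX.
have ms k i := fun y => measurable_sweep n k i y mX.
elim: j jm => [_|j IH jm].
  apply: expfam_ext fX => // -[y1 y2]; rewrite mem_box xpair_eqE => /and3P[/= h1 h2 h3].
  apply/funext => u; rewrite /sweep /= leqn0.
  case: y2 h1 h3 => [|y2] h1 h3; last first.
    rewrite /= eqSS; case: y1 h1 h2 => [|y1] h1 h2 /=; last by rewrite andbF.
    by rewrite if_same /vinc /= addrAC subrr add0r.
  case: y1 h1 h2 => [|y1] //= _ _; by rewrite /hinc /= addrAC subrr add0r.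
(* Row [j.+1], cell by cell; a completed row is the start of the next one. *)
have step i : (i <= n)%N -> expfam P (box n m) (burke_rate a b) (sweep X n j i).
  elim: i => [_|i IHi iN]; first exact/IH/ltnW.
  rewrite sweep_step; apply: expfam_burke => //; first exact/IHi/ltnW.
  - by split; rewrite mem_box /= ?leq0n ?iN ?jm.
  - by split; rewrite xpair_eqE //= andbF.
apply: expfam_ext (step n (leqnn n)) => // -[y1 y2].
rewrite mem_box xpair_eqE => /and3P[/= h1 h2 h3].
apply/funext => u; rewrite /sweep /= leqn0 h2.
case: y2 h1 h3 => [|y2] h1 h3 /=.
  by case: y1 h1 h2 => [|y1].
case: y1 h1 h2 => [|y1] h1 h2 /=.
  rewrite !eqSS [(y2 < j.+1)%N]ltnS leq_eqVlt.
  by case: (eqVneq y2 j) => [->|_] /=; [rewrite ltnn|rewrite if_same].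
by rewrite andbF orbF andbT orbC -leq_eqVlt.
Qed.

(** The output theorem for the stationary model: the horizontal increments along the row
    [m] are independent exponentials of rate [a]. *)
Lemma expfam_top X a b n m : expfam P (box n m) (burke_rate a b) X ->
  expfam P [seq (k, 0)%N | k <- iota 1 n] (fun=> a)
    (fun y u => hinc (weights X u) y.1 m).
Proof.
move=> fX; have [_ mX _ _] := fX.
have ss : {subset [seq (k, 0)%N | k <- iota 1 n] <= box n m}.
  move=> _ /mapP[[|k] + ->]; rewrite mem_iota mem_box//= add1n ltnS => kn.
  by rewrite kn.
have us' : uniq [seq (k, 0)%N | k <- iota 1 n].
  by rewrite map_inj_uniq ?iota_uniq// => x y [].
have fs := expfam_sub us' ss (expfam_sweep (leqnn m) fX).
have [_ mS iS eS] : expfam P [seq (k, 0)%N | k <- iota 1 n] (burke_rate a b)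
    (fun y u => hinc (weights X u) y.1 m).
  apply: expfam_ext fs.
    by move=> k; apply: measurable_funB; exact: measurable_lpp0.
  move=> _ /mapP[k + ->]; rewrite mem_iota => /andP[k0 kn].
  by apply/funext => u; rewrite /sweep /= leqNgt k0.
split=> // y ys; have := eS _ ys.
by case/mapP: ys => k _ ->.
Qed.

End sweep.

(** * The stationary model built from the given weights *)

Section stationary_model.
Context d (T : measurableType d) (R : realType) (P : probability T R).
Context (xi : nat * nat -> {RV P >-> R}) (alpha : R) (alpha_gt0 : 0 < alpha).
Hypothesis xi_indep : mutually_independent pos_quadrant xi.
Hypothesis xi_exp : identically_distributed pos_quadrant xi (exponential_prob alpha).

Let xif (y : nat * nat) : T -> R := xi y.
Let mxi y : measurable_fun setT (xif y).
Proof. exact: measurable_funP. Qed.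

(** Any finite subfamily of the given weights is independent exponential. *)
Lemma expfam_xi (s : seq (nat * nat)) : uniq s -> {subset s <= pos_quadrant} ->
  expfam P s (fun=> alpha) xif.
Proof.
move=> us sD; split=> //.
- move=> A mA; pose J := [fset y in s]%fset.
  have JD : [set` J] `<=` pos_quadrant.
    by move=> y /=; rewrite inE => /sD; rewrite inE.
  have := xi_indep JD (fun i _ => mA i).
  have Js : perm_eq J s by apply: uniq_perm => // y; rewrite inE.
  rewrite (perm_big s Js) => <-.
  by congr (P _); rewrite /rect -(perm_big s Js) -bigcap_seq.
- move=> y ys; apply: exp_law_of_distribution => // A mA.
  by apply: xi_exp => //; have := sD _ ys; rewrite inE.
Qed.

Section parameters.
Variables (a b : R).
Hypothesis a0 : 0 < a.
Hypothesis b0 : 0 < b.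
Hypothesis abE : a + b = alpha.

(** The weight [xi y] used at each point of the box: interior points are translated by
    [(p, q)], and the two axes are sent to the row and the column of index [L], which
    lie beyond the translated box.  The value at the origin is irrelevant. *)
Definition embed p q n m (y : nat * nat) : nat * nat :=
  let L := (p + q + n + m).+1 in
  if y.2 == 0%N then (y.1, L) else if y.1 == 0%N then (L, y.2)
  else (y.1 + p, y.2 + q)%N.

Lemma embed_uniq p q n m : uniq [seq embed p q n m y | y <- box n m].
Proof.
rewrite map_inj_in_uniq ?box_uniq// => -[x1 x2] [y1 y2].
rewrite !mem_box /embed !xpair_eqE /= => /and3P[x0 xn xm] /and3P[y0 yn ym].
case: x2 x0 xm => [|x2] x0 xm; case: y2 y0 ym => [|y2] y0 ym /=.
- by move=> [->].
- case: y1 yn y0 => [|y1] yn y0 /= [e1 e2]; lia.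
- case: x1 xn x0 => [|x1] xn x0 /= [e1 e2]; lia.
- case: x1 xn x0 => [|x1] xn x0; case: y1 yn y0 => [|y1] yn y0 /=.
  + by move=> [->].
  + by move=> [e1 e2]; lia.
  + by move=> [e1 e2]; lia.
  + by move=> [e1 e2]; congr (_, _); lia.
Qed.

(** The stationary weights; rescaling [xi] by [alpha / r] gives the rate [r].  The value at
    the origin is 0. *)
Definition stationary p q n m (y : nat * nat) : T -> R :=
  if y == (0, 0)%N then cst 0
  else fun u => alpha / burke_rate a b y * xif (embed p q n m y) u.

Lemma burke_rate_gt0 y : 0 < burke_rate a b y.
Proof. by rewrite /burke_rate; do 2 case: ifP => // _; rewrite addr_gt0. Qed.

Lemma measurable_stationary p q n m y : measurable_fun setT (stationary p q n m y).
Proof.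
by rewrite /stationary; case: ifP => _; [exact: measurable_cst|exact: measurable_funM].
Qed.

Lemma expfam_stationary p q n m : expfam P (box n m) (burke_rate a b) (stationary p q n m).
Proof.
have h : expfam P [seq embed p q n m y | y <- box n m] (fun=> alpha) xif.
  apply: expfam_xi; first exact: embed_uniq.
  move=> _ /mapP[[y1 y2] + ->]; rewrite mem_box xpair_eqE inE /embed /= => /and3P[y0 yn ym].
  by case: y2 y0 ym => [|y2]; case: y1 yn => [|y1].
have c0 y : 0 < alpha / burke_rate a b y by rewrite divr_gt0// burke_rate_gt0.
have := expfam_scale c0 (expfam_map (0, 0)%N h).
move=> /expfam_rate-/(_ (burke_rate a b)) => h1.
apply: expfam_ext (h1 _); first exact: measurable_stationary.
  by move=> y; rewrite mem_box /stationary => /andP[/negbTE ->].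
move=> y _ /=; rewrite invfM invrK mulrA divff ?mul1r// gt_eqF//.
Qed.

(** The null event on which some weight is negative. *)
Definition neg_weight : set T := \bigcup_i \bigcup_j [set u | xif (i.+1, j.+1) u < 0].

Lemma measurable_neg_weight : measurable neg_weight.
Proof.
apply: bigcupT_measurable => i; apply: bigcupT_measurable => j.
have -> : [set u | xif (i.+1, j.+1) u < 0] = xif (i.+1, j.+1) @^-1` `]-oo, 0[.
  by apply/seteqP; split => u /=; rewrite in_itv.
exact: preimage_measurable.
Qed.

Lemma neg_weight0 : P neg_weight = 0%E.
Proof.
have m1 i j : measurable [set u | xif (i.+1, j.+1) u < 0].
  have -> : [set u | xif (i.+1, j.+1) u < 0] = xif (i.+1, j.+1) @^-1` `]-oo, 0[.
    by apply/seteqP; split => u /=; rewrite in_itv.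
  exact: preimage_measurable.
have h1 i j : P [set u | xif (i.+1, j.+1) u < 0] = 0%E.
  have -> : [set u | xif (i.+1, j.+1) u < 0] = xif (i.+1, j.+1) @^-1` `]-oo, 0[.
    by apply/seteqP; split => u /=; rewrite in_itv.
  transitivity (exponential_prob alpha `]-oo, 0%R[).
    exact: (@xi_exp (i.+1, j.+1)).
  apply: integral0_eq => x /=; rewrite in_itv/= => x0.
  by rewrite lt0_exponential_pdf.
apply/negligibleP; first exact: measurable_neg_weight.
apply: negligible_bigcup => i; apply: negligible_bigcup => j.
by apply/negligibleP; [exact: m1|exact: h1].
Qed.

Lemma stationary_ge0 p q n m u : ~ neg_weight u ->
  forall y, 0 <= weights (stationary p q n m) u y.
Proof.
move=> nu y; rewrite /weights /stationary; case: (eqVneq y (0, 0)%N) => // y0.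
rewrite mulr_ge0//; first by rewrite ltW// divr_gt0// burke_rate_gt0.
have [z1 [z2 zE]] : exists z1 z2, embed p q n m y = (z1.+1, z2.+1).
  case: y y0 => [[|y1] [|y2]] //= _; rewrite /embed /= ?addSn; by eexists; eexists.
rewrite zE leNgt; apply/negP => h; apply: nu.
by exists z1 => //; exists z2.
Qed.

(** Off the axes, the stationary weights are the original ones. *)
Lemma stationary_interior p q n m u k l i j :
  lpp (wshift k.+1 l.+1 (weights (stationary p q n m) u)) i j =
  lpp (wshift (k + p).+1 (l + q).+1 (weights xif u)) i j.
Proof.
apply: eq_lpp => -[y1 y2]; rewrite /wshift /weights /stationary /embed /burke_rate /=.
by rewrite !addnS /= abE divff ?gt_eqF// mul1r !addSn !addnA.
Qed.

End parameters.
End stationary_model.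

(** * Tail bounds for the stationary model, and the upper tail *)

Section tails.
Context d (T : measurableType d) (R : realType) (P : probability T R).
Context (xi : nat * nat -> {RV P >-> R}) (alpha : R) (alpha_gt0 : 0 < alpha).
Hypothesis xi_indep : mutually_independent pos_quadrant xi.
Hypothesis xi_exp : identically_distributed pos_quadrant xi (exponential_prob alpha).
Let xif (y : nat * nat) : T -> R := xi y.
Let mxi y : measurable_fun setT (xif y).
Proof. exact: measurable_funP. Qed.

Section parameters.
Variables (a b : R).
Hypothesis a0 : 0 < a.
Hypothesis b0 : 0 < b.
Hypothesis abE : a + b = alpha.

Let X := stationary xi alpha a b.
Let fX p q n m := @expfam_stationary _ _ _ P xi alpha alpha_gt0 xi_indep xi_exp a b a0 b0 p q n m.
Let mX p q n m := @measurable_stationary _ _ _ P xi alpha a b p q n m.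

Lemma expfam_left p q n m l : (l <= m)%N ->
  expfam P [seq (0, k)%N | k <- iota 1 l] (fun=> b) (X p q n m).
Proof.
move=> lm; have us : uniq [seq (0, k)%N | k <- iota 1 l].
  by rewrite map_inj_uniq ?iota_uniq// => x y [].
apply: expfam_rate (expfam_sub us _ (fX p q n m)).
  by move=> _ /mapP[[|k] + ->]; rewrite mem_iota.
move=> _ /mapP[[|k] + ->]; rewrite mem_iota mem_box//= add1n ltnS => kn.
exact: leq_trans kn lm.
Qed.

Lemma expfam_bottom p q n m l : (l <= n)%N ->
  expfam P [seq (k, 0)%N | k <- iota 1 l] (fun=> a) (X p q n m).
Proof.
move=> lm; have us : uniq [seq (k, 0)%N | k <- iota 1 l].
  by rewrite map_inj_uniq ?iota_uniq// => x y [].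
apply: expfam_rate (expfam_sub us _ (fX p q n m)).
  by move=> _ /mapP[[|k] + ->]; rewrite mem_iota.
move=> _ /mapP[[|k] + ->]; rewrite mem_iota mem_box//= add1n ltnS => kn.
by rewrite andbT; exact: leq_trans kn lm.
Qed.

Let stationary00 p q n m u : weights (X p q n m) u (0, 0)%N = 0.
Proof. by []. Qed.

Lemma lpp_left_stationary p q n m l u : lpp (weights (X p q n m) u) 0 l =
  \sum_(y <- [seq (0, k)%N | k <- iota 1 l]) X p q n m y u.
Proof. by rewrite lpp_left_sum stationary00 add0r big_map. Qed.

Lemma lpp_bottom_stationary p q n m l u : lpp (weights (X p q n m) u) l 0 =
  \sum_(y <- [seq (k, 0)%N | k <- iota 1 l]) X p q n m y u.
Proof. by rewrite lpp_bottom_sum stationary00 add0r big_map. Qed.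

(** Upper deviations of the partial sums along the axes. *)
Lemma bottom_tail (C dl : R) : 0 < C -> 0 < dl ->
  exists2 kp : R, 0 < kp & forall N p q n m l, (l <= n)%N -> n%:R <= C * N%:R ->
    (P [set u | (l%:R / a + dl * N%:R <= lpp (weights (X p q n m) u) l 0)%R] <=
      (expR (- (kp * N%:R)))%:E)%E.
Proof.
move=> C0 dl0; have [kp kp0 h] := @sum_exp_deviation _ _ _ P (nat * nat)%type a C dl a0 C0 dl0.
exists kp => // N p q n m l ln nC.
have := h N _ _ _ (expfam_bottom p q m ln).
rewrite size_map size_iota => /(_ (fun _ _ => erefl)) [|+ _].
  by rewrite (le_trans _ nC)// ler_nat.
by apply: le_trans; rewrite le_measure ?inE//; last (by move=> u /=; rewrite lpp_bottom_stationary);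
  apply: measurable_set_ge; [exact: measurable_lpp0 | exact: measurable_sum_seq].
Qed.

Lemma left_tail (C dl : R) : 0 < C -> 0 < dl ->
  exists2 kp : R, 0 < kp & forall N p q n m l, (l <= m)%N -> m%:R <= C * N%:R ->
    (P [set u | (l%:R / b + dl * N%:R <= lpp (weights (X p q n m) u) 0 l)%R] <=
      (expR (- (kp * N%:R)))%:E)%E.
Proof.
move=> C0 dl0; have [kp kp0 h] := @sum_exp_deviation _ _ _ P (nat * nat)%type b C dl b0 C0 dl0.
exists kp => // N p q n m l ln nC.
have := h N _ _ _ (expfam_left p q n ln).
rewrite size_map size_iota => /(_ (fun _ _ => erefl)) [|+ _].
  by rewrite (le_trans _ nC)// ler_nat.
by apply: le_trans; rewrite le_measure ?inE//; last (by move=> u; rewrite /mkset lpp_left_stationary);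
  apply: measurable_set_ge; [exact: measurable_lpp0 | exact: measurable_sum_seq].
Qed.

(** Both tails of the last passage value of the stationary model, which is the sum of the
    increments along the left side and the top row. *)
Lemma stationary_tails (C dl : R) : 0 < C -> 0 < dl ->
  exists2 kp : R, 0 < kp & forall N p q n m, n%:R <= C * N%:R -> m%:R <= C * N%:R ->
    (P [set u | (n%:R / a + m%:R / b + dl * N%:R <= lpp (weights (X p q n m) u) n m)%R] <=
      (2 * expR (- (kp * N%:R)))%:E)%E /\
    (P [set u | (lpp (weights (X p q n m) u) n m <= n%:R / a + m%:R / b - dl * N%:R)%R] <=
      (2 * expR (- (kp * N%:R)))%:E)%E.
Proof.
move=> C0 dl0; have dl2 : 0 < dl / 2 by rewrite divr_gt0.
have [k1 k10 h1] := @sum_exp_deviation _ _ _ P (nat * nat)%type a C _ a0 C0 dl2.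
have [k2 k20 h2] := @sum_exp_deviation _ _ _ P (nat * nat)%type b C _ b0 C0 dl2.
exists (Num.min k1 k2); first by rewrite lt_min k10.
move=> N p q n m nC mC.
have e1 : expR (- (k1 * N%:R)) <= expR (- (Num.min k1 k2 * N%:R)) :> R.
  by rewrite ler_expR lerN2 ler_wpM2r// ge_min lexx.
have e2 : expR (- (k2 * N%:R)) <= expR (- (Num.min k1 k2 * N%:R)) :> R.
  by rewrite ler_expR lerN2 ler_wpM2r// ge_min lexx orbT.
have ft := expfam_top (fX p q n m).
have [_ mt _ _] := ft.
have := h1 N _ _ _ ft (fun _ _ => erefl).
rewrite size_map size_iota => /(_ nC) [u1 l1].
have := h2 N _ _ _ (expfam_left p q n (leqnn m)) (fun _ _ => erefl).
rewrite size_map size_iota => /(_ mC) [u2 l2].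
have mH : measurable_fun setT (fun u => lpp (weights (X p q n m) u) n m).
  exact: measurable_lpp0.
have HE u : lpp (weights (X p q n m) u) n m =
   \sum_(y <- [seq (0, k)%N | k <- iota 1 m]) X p q n m y u +
   \sum_(y <- [seq (k, 0)%N | k <- iota 1 n]) hinc (weights (X p q n m) u) y.1 m.
  by rewrite lpp_hinc_sum lpp_left_stationary !big_map.
have E2 : 2 * expR (- (Num.min k1 k2 * N%:R)) =
   expR (- (Num.min k1 k2 * N%:R)) + expR (- (Num.min k1 k2 * N%:R)) :> R.
  by rewrite mulr_natl mulr2n.
have mS1 := measurable_sum_seq [seq (0, k)%N | k <- iota 1 m] (mX p q n m).
have mS2 := measurable_sum_seq [seq (k, 0)%N | k <- iota 1 n] mt.
split; rewrite E2.
- apply: (union_bound2 _ _ _ _ (le_trans u1 _) (le_trans u2 _)); rewrite ?lee_fin//.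
  + exact: measurable_set_ge.
  + exact: measurable_set_ge.
  + exact: measurable_set_ge.
  + move=> u /=; rewrite HE => h.
    have [g|g] := leP (n%:R / a + dl / 2 * N%:R)
      (\sum_(y <- [seq (k, 0)%N | k <- iota 1 n]) hinc (weights (X p q n m) u) y.1 m).
      by left.
    right; lra.
- apply: (union_bound2 _ _ _ _ (le_trans l1 _) (le_trans l2 _)); rewrite ?lee_fin//.
  + exact: measurable_set_le.
  + exact: measurable_set_le.
  + exact: measurable_set_le.
  + move=> u /=; rewrite HE => h.
    have [g|g] := leP (\sum_(y <- [seq (k, 0)%N | k <- iota 1 n]) hinc (weights (X p q n m) u) y.1 m)
      (n%:R / a - dl / 2 * N%:R).
      by left.
    right; lra.
Qed.

(** Upper tail of the last passage value of an interior rectangle with an arbitrary starting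
    point, for any admissible pair of rates. *)
Lemma upper_tail (C dl : R) : 0 < C -> 0 < dl ->
  exists2 kp : R, 0 < kp & forall N p q n m, n.+1%:R <= C * N%:R -> m.+1%:R <= C * N%:R ->
    (P [set u | (n.+1%:R / a + m.+1%:R / b + dl * N%:R <=
        lpp (wshift p.+1 q.+1 (weights xif u)) n m)%R] <=
      (2 * expR (- (kp * N%:R)))%:E)%E.
Proof.
move=> C0 dl0; have [kp kp0 h] := stationary_tails C0 dl0.
exists kp => // N p q n m nC mC.
apply: le_trans (h N p q n.+1 m.+1 nC mC).1.
apply: le_measure_null (neg_weight0 xi_exp) _.
- by apply: measurable_set_ge; exact: measurable_lpp.
- by apply: measurable_set_ge; exact: measurable_lpp0.
- exact: measurable_neg_weight.
move=> u /= hu; have [nu|nu] := pselect (neg_weight xi u); [by right|left].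
apply: le_trans hu _; rewrite -[p]add0n -[q]add0n -(stationary_interior xi alpha_gt0 abE _ _ n.+1 m.+1).
apply: (le_trans (lpp_shift_le _ _ _ _ _)); first exact: stationary_ge0.
by rewrite !addn1.
Qed.

End parameters.
End tails.

(** * The cost of following an axis for a long time *)

Section constants.
Context (R : realType).

(** A path that follows the horizontal axis over a distance [k >= eps * Nr] and then is
    bounded by the modified rates [a - eta], [b + eta] stays below [n / a + m / b], with
    room for an error [3 * dl * Nr].  The hypothesis [n / a ^+ 2 <= m / b ^+ 2 + e0]
    says that [(a, b)] is nearly critical for the direction [(n, m)], and removes the
    term of first order in [eta]. *)
Lemma detour_loss (a b C eps e0 : R) : 0 < a -> 0 < b -> 0 < C -> 0 < eps -> 0 <= e0 ->
  exists eta, exists2 dl1, [/\ 0 < eta, eta < a & 0 < dl1] &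
  exists N0 : R, forall dl, dl <= dl1 -> forall Nr n m k : R,
    N0 <= Nr -> 0 < Nr -> 0 <= n <= C * Nr -> 0 <= m <= C * Nr -> eps * Nr <= k ->
    n / a ^+ 2 <= m / b ^+ 2 + e0 ->
    k / a + (n - k + 1) / (a - eta) + m / (b + eta) + 3 * dl * Nr < n / a + m / b.
Proof.
move=> a0 b0 C0 eps0 e00.
pose A := a^-1; pose B := b^-1.
have A0 : 0 < A by rewrite invr_gt0.
have B0 : 0 < B by rewrite invr_gt0.
pose Q := 2 * A ^+ 3 + B ^+ 3.
have Q0 : 0 < Q by rewrite addr_gt0 ?mulr_gt0 ?exprn_gt0.
(* Per unit of [Nr], the second order cost [eta ^+ 2 * C * Q] is at most half of the first
   order gain [eta * eps * A ^+ 2]. *)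
pose eta := Num.min (a / 2) (eps * A ^+ 2 / (2 * C * Q)).
have eta0 : 0 < eta.
  by rewrite lt_min !divr_gt0 ?mulr_gt0 ?exprn_gt0.
have eta_a : eta <= a / 2 by rewrite ge_min lexx.
have etaQ : eta * C * Q <= eps * A ^+ 2 / 2.
  rewrite -mulrA -ler_pdivlMr ?mulr_gt0//.
  rewrite (_ : _ / _ / _ = eps * A ^+ 2 / (2 * C * Q)); first by rewrite ge_min lexx orbT.
  by field; rewrite !gt_eqF.
pose dl1 := eps * eta * A ^+ 2 / 12.
have dl10 : 0 < dl1 by rewrite divr_gt0// !mulr_gt0// exprn_gt0.
exists eta, dl1; first by split => //; lra.
exists ((eta * e0 + 2 * A) * 4 / (eps * eta * A ^+ 2) + 1).
move=> dl dl_le Nr n m k NN Nr0 /andP[n0 nC] /andP[m0 mC] kN hnm.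
set x := (a - eta)^-1; set y := (b + eta)^-1.
have aeta : 0 < a - eta by lra.
have x0 : 0 < x by rewrite invr_gt0.
have y0 : 0 < y by rewrite invr_gt0; lra.
have xE : x = A + eta * x * A by rewrite /x /A; field; rewrite !gt_eqF.
have yE : y = B - eta * y * B by rewrite /y /B; field; rewrite !gt_eqF//; lra.
have xA : x <= 2 * A.
  rewrite /x /A (_ : 2 * a^-1 = (a / 2)^-1); last by field; rewrite gt_eqF.
  by rewrite lef_pV2 ?posrE// ?divr_gt0//; lra.
have Ax : A <= x by rewrite xE lerDl !mulr_ge0// ltW.
have yB : y <= B by rewrite yE gerBl !mulr_ge0// ltW.
have k0 : 0 < k by apply: lt_le_trans kN; rewrite mulr_gt0.
(* Expansions of [x] and [y] around [A] and [B]. *)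
have h1 : n * x <= n * A + n * eta * A ^+ 2 + 2 * n * eta ^+ 2 * A ^+ 3.
  have e : n * x = n * A + n * eta * A ^+ 2 + n * eta ^+ 2 * A ^+ 2 * x.
    rewrite {1}xE {1}xE; ring.
  rewrite e lerD2l.
  have : n * eta ^+ 2 * A ^+ 2 * x <= n * eta ^+ 2 * A ^+ 2 * (2 * A).
    by rewrite ler_wpM2l// -mulrA mulr_ge0// -exprMn sqr_ge0.
  by move/le_trans; apply; rewrite le_eqVlt; apply/orP; left; apply/eqP; ring.
have h2 : k * A + k * eta * A ^+ 2 <= k * x.
  have -> : k * x = k * A + k * eta * A * x by rewrite {1}xE; ring.
  rewrite lerD2l expr2 mulrA ler_wpM2l// !mulr_ge0// ltW//.
have h3 : m * y <= m * B - m * eta * B ^+ 2 + m * eta ^+ 2 * B ^+ 3.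
  have e : m * y = m * B - m * eta * B ^+ 2 + m * eta ^+ 2 * B ^+ 2 * y.
    rewrite {1}yE {1}yE; ring.
  rewrite e lerD2l.
  have : m * eta ^+ 2 * B ^+ 2 * y <= m * eta ^+ 2 * B ^+ 2 * B.
    by rewrite ler_wpM2l// -mulrA mulr_ge0// -exprMn sqr_ge0.
  by move/le_trans; apply; rewrite le_eqVlt; apply/orP; left; apply/eqP; ring.
have h4 : eta * (n * A ^+ 2) <= eta * (m * B ^+ 2 + e0).
  by rewrite ler_pM2l//; move: hnm; rewrite -!exprVn.
have h5 : eta ^+ 2 * (2 * n * A ^+ 3 + m * B ^+ 3) <= eta * (eps * A ^+ 2 / 2) * Nr.
  apply: (@le_trans _ _ (eta ^+ 2 * (C * Nr * Q))).
    have q1 : n * (2 * A ^+ 3) <= C * Nr * (2 * A ^+ 3).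
      by rewrite ler_wpM2r// mulr_ge0// exprn_ge0// ltW.
    have q2 : m * B ^+ 3 <= C * Nr * B ^+ 3.
      by rewrite ler_wpM2r// exprn_ge0// ltW.
    by rewrite ler_wpM2l ?sqr_ge0// /Q; lra.
  rewrite (_ : eta ^+ 2 * (C * Nr * Q) = eta * (eta * C * Q) * Nr); last by ring.
  by rewrite ler_pM2r// ler_pM2l.
have h6 : eps * Nr * (eta * A ^+ 2) <= k * (eta * A ^+ 2).
  by rewrite ler_wpM2r// mulr_ge0 ?sqr_ge0// ltW.
have h7 : 3 * dl * Nr <= eps * eta * A ^+ 2 / 4 * Nr.
  by rewrite ler_pM2r//; move: dl_le; rewrite /dl1; lra.
have h8 : eta * e0 + 2 * A < eps * eta * A ^+ 2 / 4 * Nr.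
  have c0 : 0 < eps * eta * A ^+ 2 by rewrite !mulr_gt0 ?exprn_gt0.
  have : (eta * e0 + 2 * A) * 4 / (eps * eta * A ^+ 2) < Nr by lra.
  by rewrite ltr_pdivrMr//; lra.
rewrite -[a^-1]/A -[b^-1]/B.
clear - h1 h2 h3 h4 h5 h6 h7 h8 xA.
lra.
Qed.

End constants.

(** * The lower tail *)

Section lower.
Context d (T : measurableType d) (R : realType) (P : probability T R).

Context (xi : nat * nat -> {RV P >-> R}) (alpha : R) (alpha_gt0 : 0 < alpha).
Hypothesis xi_indep : mutually_independent pos_quadrant xi.
Hypothesis xi_exp : identically_distributed pos_quadrant xi (exponential_prob alpha).
Let xif (y : nat * nat) : T -> R := xi y.
Let mxi y : measurable_fun setT (xif y).
Proof. exact: measurable_funP. Qed.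
Variables (a b : R).
Hypothesis a0 : 0 < a.
Hypothesis b0 : 0 < b.
Hypothesis abE : a + b = alpha.
Let X := stationary xi alpha a b.
Let mX p q n m := @measurable_stationary _ _ _ P xi alpha a b p q n m.

Lemma wshift_lpp_le u p q n m : ~ neg_weight xi u ->
  lpp (wshift p.+1 q.+1 (weights xif u)) n m <=
  lpp (wshift 1 1 (weights xif u)) (n + p)%N (m + q)%N.
Proof.
move=> nu; have -> : wshift p.+1 q.+1 (weights xif u) = wshift p q (wshift 1 1 (weights xif u)).
  by apply/funext => y; rewrite /wshift /= !addn1 !addnS.
apply: lpp_shift_le => -[y1 y2]; rewrite /wshift /weights /= !addn1 leNgt.
by apply/negP => h; apply: nu; exists y1 => //; exists y2.
Qed.

(** The two hypotheses on [n / a ^+ 2] and [m / b ^+ 2] say that [(a, b)] is nearly critical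
    for the direction [(n, m)]. *)
Lemma lower_tail (C dl e0 : R) : 0 < C -> 0 < dl -> 0 <= e0 ->
  exists2 kp : R, 0 < kp & exists N0 : R, forall N n m, N0 <= N%:R -> (0 < N)%N ->
    n.+1%:R <= C * N%:R -> m.+1%:R <= C * N%:R ->
    n.+1%:R / a ^+ 2 <= m.+1%:R / b ^+ 2 + e0 ->
    m.+1%:R / b ^+ 2 <= n.+1%:R / a ^+ 2 + e0 ->
    (P [set u | (lpp (wshift 1 1 (weights xif u)) n m <=
        n.+1%:R / a + m.+1%:R / b - dl * N%:R)%R] <=
      ((2 + 3 * n.+1%:R + 3 * m.+1%:R) * expR (- (kp * N%:R)))%:E)%E.
Proof.
move=> C0 dl0 e00.
pose eps := dl / 4 * Num.min a b.
have dl4 : 0 < dl / 4 by rewrite divr_gt0.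
have eps0 : 0 < eps by rewrite mulr_gt0// lt_min a0.
have epsa : eps / a <= dl / 4.
  by rewrite ler_pdivrMr// ler_pM2l// ge_min lexx.
have epsb : eps / b <= dl / 4.
  by rewrite ler_pdivrMr// ler_pM2l// ge_min lexx orbT.
have [t1 [d1 [t10 t1a d10] [N1 core1]]] := detour_loss a0 b0 C0 eps0 e00.
have [t2 [d2 [t20 t2b d20] [N2 core2]]] := detour_loss b0 a0 C0 eps0 e00.
pose dl' := Num.min (Num.min d1 d2) (dl / 4).
have dl'0 : 0 < dl' by rewrite !lt_min d10 d20 divr_gt0.
have dl'1 : dl' <= d1 by rewrite !ge_min lexx.
have dl'2 : dl' <= d2 by rewrite !ge_min lexx orbT.
have dl'3 : dl' <= dl / 4 by rewrite !ge_min lexx orbT.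
have [k0 k00 H0] := stationary_tails alpha_gt0 xi_indep xi_exp a0 b0 C0 dl'0.
have [k1 k10 H1] := bottom_tail alpha_gt0 xi_indep xi_exp a0 b0 C0 dl'0.
have [k2 k20 H2] := left_tail alpha_gt0 xi_indep xi_exp a0 b0 C0 dl'0.
have a1 : 0 < a - t1 by rewrite subr_gt0.
have b1 : 0 < b + t1 by rewrite addr_gt0.
have ab1 : (a - t1) + (b + t1) = alpha by rewrite -abE; ring.
have a2 : 0 < a + t2 by rewrite addr_gt0.
have b2 : 0 < b - t2 by rewrite subr_gt0.
have ab2 : (a + t2) + (b - t2) = alpha by rewrite -abE; ring.
have [k3 k30 H3] := upper_tail alpha_gt0 xi_indep xi_exp a1 b1 ab1 C0 dl'0.
have [k4 k40 H4] := upper_tail alpha_gt0 xi_indep xi_exp a2 b2 ab2 C0 dl'0.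
pose kp := Num.min k0 (Num.min (Num.min k1 k2) (Num.min k3 k4)).
exists kp; first by rewrite !lt_min k00 k10 k20 k30.
exists (Num.max N1 N2) => N n m; rewrite ge_max => /andP[N1N N2N] N0 nC mC bal1 bal2.
have Nr0 : 0 < N%:R :> R by rewrite ltr0n.
set x := expR (- (kp * N%:R)).
have lex k : kp <= k -> expR (- (k * N%:R)) <= x.
  by move=> kk; rewrite /x ler_expR lerN2 ler_wpM2r.
have x0 : expR (- (k0 * N%:R)) <= x by apply: lex; rewrite /kp !ge_min lexx.
have x1 : expR (- (k1 * N%:R)) <= x by apply: lex; rewrite /kp !ge_min lexx !orbT.
have x2 : expR (- (k2 * N%:R)) <= x by apply: lex; rewrite /kp !ge_min lexx !orbT.
have x3 : expR (- (k3 * N%:R)) <= x by apply: lex; rewrite /kp !ge_min lexx !orbT.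
have x4 : expR (- (k4 * N%:R)) <= x by apply: lex; rewrite /kp !ge_min lexx !orbT.
pose G u := lpp (wshift 1 1 (weights xif u)) n m.
pose H u := lpp (weights (X 0 0 n.+1 m.+1) u) n.+1 m.+1.
pose Sh k u := lpp (weights (X 0 0 n.+1 m.+1) u) k.+1 0.
pose Sv k u := lpp (weights (X 0 0 n.+1 m.+1) u) 0 k.+1.
pose Gh k u := lpp (wshift k.+1 1 (weights xif u)) (n - k) m.
pose Gv k u := lpp (wshift 1 k.+1 (weights xif u)) n (m - k).
have mG : measurable_fun setT G by exact: measurable_lpp.
have mH : measurable_fun setT H by exact: measurable_lpp0.
have mSh k : measurable_fun setT (Sh k) by exact: measurable_lpp0.
have mSv k : measurable_fun setT (Sv k) by exact: measurable_lpp0.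
have mGh k : measurable_fun setT (Gh k) by exact: measurable_lpp.
have mGv k : measurable_fun setT (Gv k) by exact: measurable_lpp.
(* The bad events: [H] is too small, a partial sum along an axis is too large ([F1], [F2]),
   or the last passage value from an exit point is too large ([F3], [F4]). *)
pose F0 := [set u | H u <= n.+1%:R / a + m.+1%:R / b - dl' * N%:R].
pose F1 k := [set u | k.+1%:R / a + dl' * N%:R <= Sh k u].
pose F2 k := [set u | k.+1%:R / b + dl' * N%:R <= Sv k u].
pose F3 k := [set u | (n - k).+1%:R / (a - t1) + m.+1%:R / (b + t1) + dl' * N%:R <= Gh k u].
pose F4 k := [set u | n.+1%:R / (a + t2) + (m - k).+1%:R / (b - t2) + dl' * N%:R <= Gv k u].
have mF0 : measurable F0 by exact: measurable_set_le.
have pF0 : (P F0 <= (2 * x)%:E)%E.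
  by apply: le_trans (H0 N 0 0 n.+1 m.+1 nC mC).2 _; rewrite lee_fin ler_pM2l.
have [mF1 pF1] : measurable (\bigcup_(k in `I_n.+1) F1 k) /\
    (P (\bigcup_(k in `I_n.+1) F1 k) <= (n.+1%:R * x)%:E)%E.
  apply: union_boundn => k kn; split; first exact: measurable_set_ge.
  by apply: le_trans (H1 N 0 0 n.+1 m.+1 k.+1 kn nC) _; rewrite lee_fin.
have [mF2 pF2] : measurable (\bigcup_(k in `I_m.+1) F2 k) /\
    (P (\bigcup_(k in `I_m.+1) F2 k) <= (m.+1%:R * x)%:E)%E.
  apply: union_boundn => k kn; split; first exact: measurable_set_ge.
  by apply: le_trans (H2 N 0 0 n.+1 m.+1 k.+1 kn mC) _; rewrite lee_fin.
have [mF3 pF3] : measurable (\bigcup_(k in `I_n.+1) F3 k) /\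
    (P (\bigcup_(k in `I_n.+1) F3 k) <= (n.+1%:R * (2 * x))%:E)%E.
  apply: union_boundn => k kn; split; first exact: measurable_set_ge.
  apply: le_trans (H3 N k 0 (n - k)%N m _ mC) _; last by rewrite lee_fin ler_pM2l.
  by apply: le_trans nC; rewrite ler_nat ltnS leq_subr.
have [mF4 pF4] : measurable (\bigcup_(k in `I_m.+1) F4 k) /\
    (P (\bigcup_(k in `I_m.+1) F4 k) <= (m.+1%:R * (2 * x))%:E)%E.
  apply: union_boundn => k kn; split; first exact: measurable_set_ge.
  apply: le_trans (H4 N 0 k n (m - k)%N nC _) _; last by rewrite lee_fin ler_pM2l.
  by apply: le_trans mC; rewrite ler_nat ltnS leq_subr.
pose F := F0 `|` (\bigcup_(k in `I_n.+1) F1 k `|` \bigcup_(k in `I_m.+1) F2 k)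
  `|` (\bigcup_(k in `I_n.+1) F3 k `|` \bigcup_(k in `I_m.+1) F4 k).
have mF12 := measurableU _ _ mF1 mF2.
have mF34 := measurableU _ _ mF3 mF4.
have mF012 := measurableU _ _ mF0 mF12.
have mF : measurable F by exact: measurableU.
have pF : (P F <= ((2 + 3 * n.+1%:R + 3 * m.+1%:R) * x)%:E)%E.
  rewrite (_ : _ * x = (2 * x + (n.+1%:R * x + m.+1%:R * x)) +
     (n.+1%:R * (2 * x) + m.+1%:R * (2 * x))); last by ring.
  have uU := @union_bound2 _ _ _ P.
  have p12 := uU _ _ _ _ _ mF12 mF1 mF2 (@subset_refl _ _) pF1 pF2.
  have p34 := uU _ _ _ _ _ mF34 mF3 mF4 (@subset_refl _ _) pF3 pF4.
  have p012 := uU _ _ _ _ _ mF012 mF0 mF12 (@subset_refl _ _) pF0 p12.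
  exact: uU _ _ _ _ _ mF mF012 mF34 (@subset_refl _ _) p012 p34.
apply: le_trans pF; apply: le_measure_null (measurable_neg_weight xi) (neg_weight0 xi_exp) _ => //.
  exact: measurable_set_le.
move=> u /= Gle; have [nu|nu] := pselect (neg_weight xi u); [by right|left].
apply: contrapT => nF.
have nF0 : ~ F0 u by move=> h; apply: nF; left; left.
have nF1 k : (k <= n)%N -> ~ F1 k u.
  by move=> kn h; apply: nF; left; right; left; exists k.
have nF2 k : (k <= m)%N -> ~ F2 k u.
  by move=> kn h; apply: nF; left; right; right; exists k.
have nF3 k : (k <= n)%N -> ~ F3 k u.
  by move=> kn h; apply: nF; right; left; exists k.
have nF4 k : (k <= m)%N -> ~ F4 k u.
  by move=> kn h; apply: nF; right; right; exists k.
move/negP : nF0; rewrite -ltNge => hH.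
have NN0 : 0 <= N%:R :> R by rewrite ler0n.
have e1 : dl' * N%:R <= dl / 4 * N%:R by rewrite ler_wpM2r.
have e2 : 0 < dl * N%:R by rewrite mulr_gt0.
have [[k kn]|[k kn]] := lpp_exit (weights (X 0 0 n.+1 m.+1) u) n m; rewrite -/(H u).
- rewrite (stationary_interior xi alpha_gt0 abE) !addn0 -/(Sh k u) -/(Gh k u) => hk.
  move/negP : (nF1 _ kn); rewrite -ltNge => h1.
  move/negP : (nF3 _ kn); rewrite -ltNge => h3.
  have [ke|ke] := leP (eps * N%:R) k.+1%:R.
    have := core1 dl' dl'1 N%:R n.+1%:R m.+1%:R k.+1%:R N1N Nr0.
    rewrite !ler0n nC mC => /(_ isT isT ke bal1).
    have -> : n.+1%:R - k.+1%:R + 1 = (n - k).+1%:R :> R.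
      by rewrite -!natr1 natrB//; ring.
    lra.
  have hG : Gh k u <= G u.
    by have := wshift_lpp_le k 0 (n - k) m nu; rewrite subnK// addn0.
  have h5 : k.+1%:R / a <= dl / 4 * N%:R.
    apply: (@le_trans _ _ (eps * N%:R / a)); first by rewrite ler_pM2r ?invr_gt0// ltW.
    by rewrite mulrAC ler_wpM2r.
  by rewrite -/(G u) in Gle; lra.
- rewrite (stationary_interior xi alpha_gt0 abE) !addn0 -/(Sv k u) -/(Gv k u) => hk.
  move/negP : (nF2 _ kn); rewrite -ltNge => h1.
  move/negP : (nF4 _ kn); rewrite -ltNge => h3.
  have [ke|ke] := leP (eps * N%:R) k.+1%:R.
    have := core2 dl' dl'2 N%:R m.+1%:R n.+1%:R k.+1%:R N2N Nr0.
    rewrite !ler0n nC mC => /(_ isT isT ke bal2).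
    have -> : m.+1%:R - k.+1%:R + 1 = (m - k).+1%:R :> R.
      by rewrite -!natr1 natrB//; ring.
    lra.
  have hG : Gv k u <= G u.
    by have := wshift_lpp_le 0 k n (m - k) nu; rewrite subnK// addn0.
  have h5 : k.+1%:R / b <= dl / 4 * N%:R.
    apply: (@le_trans _ _ (eps * N%:R / b)); first by rewrite ler_pM2r ?invr_gt0// ltW.
    by rewrite mulrAC ler_wpM2r.
  by rewrite -/(G u) in Gle; lra.
Qed.

End lower.

(** * From large to all sizes *)

Section lpp_bounds.
Context (R : realType).
Implicit Types (w : nat * nat -> R).

Lemma lpp_le_cst w n m (c : R) :
  (forall i j, (i <= n)%N -> (j <= m)%N -> w (i, j) <= c) ->
  lpp w n m <= (n + m).+1%:R * c.
Proof.
elim: n m => [|n IHn]; elim=> [|m IHm] h.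
- by rewrite mul1r; exact: h.
- rewrite lpp0S addnS -natr1 mulrDl mul1r lerD ?h//.
  by apply: IHm => i j ? ?; apply: h => //; exact: leqW.
- rewrite lppS0 addSn -natr1 mulrDl mul1r lerD ?h//.
  by apply: IHn => i j ? ?; apply: h => //; exact: leqW.
- rewrite lppSS addSn -natr1 mulrDl mul1r lerD ?h// ge_max IHn/=; last first.
    by move=> i j ? ?; apply: h => //; exact: leqW.
  by rewrite addnS -addSn IHm// => i j ? ?; apply: h => //; exact: leqW.
Qed.

Lemma lpp_ge_cst w n m (c : R) :
  (forall i j, (i <= n)%N -> (j <= m)%N -> c <= w (i, j)) ->
  (n + m).+1%:R * c <= lpp w n m.
Proof.
elim: n m => [|n IHn]; elim=> [|m IHm] h.
- by rewrite mul1r; exact: h.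
- rewrite lpp0S addnS -natr1 mulrDl mul1r lerD ?h//.
  by apply: IHm => i j ? ?; apply: h => //; exact: leqW.
- rewrite lppS0 addSn -natr1 mulrDl mul1r lerD ?h//.
  by apply: IHn => i j ? ?; apply: h => //; exact: leqW.
- rewrite lppSS addSn -natr1 mulrDl mul1r lerD ?h// le_max IHn//.
  by move=> i j ? ?; apply: h => //; exact: leqW.
Qed.

Lemma linear_exp (B kp : R) : 0 < B -> 0 < kp -> exists N0 : R, forall x : R,
  N0 <= x -> 0 < x -> B * x * expR (- (kp * x)) <= expR (- (kp / 2 * x)).
Proof.
move=> B0 kp0; exists (16 * B / kp ^+ 2) => x xN x0.
have -> : - (kp * x) = - (kp / 2 * x) + - (kp / 2 * x) by field.
rewrite expRD mulrA -[leRHS]mul1r ler_pM2r ?expR_gt0// expRN.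
rewrite ler_pdivrMr ?expR_gt0// mul1r.
have -> : kp / 2 * x = kp * x / 4 + kp * x / 4 by field.
have h : kp * x / 4 <= expR (kp * x / 4).
  by apply: le_trans (expR_ge1Dx _); rewrite lerDr.
have k4 : 0 <= kp * x / 4 by rewrite divr_ge0// mulr_ge0// ltW.
rewrite expRD; apply: (@le_trans _ _ ((kp * x / 4) * (kp * x / 4))); last exact: ler_pM.
have : 16 * B <= x * kp ^+ 2 by rewrite -ler_pdivrMr// exprn_gt0.
by move=> /(ler_wpM2r (ltW x0)); lra.
Qed.

(** An exponential bound valid for large [N] extends to all [N], with a smaller rate, as soon
    as each single probability is less than 1. *)
Lemma uniform_rate (p : nat -> R) (D : nat -> bool) (c0 : R) (N0 : nat) : 0 < c0 ->
  (forall N, (N0 <= N)%N -> D N -> p N <= expR (- c0 * N%:R)) ->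
  (forall N, (0 < N)%N -> D N -> p N < 1) ->
  exists2 c : R, 0 < c & forall N, (0 < N)%N -> D N -> p N <= expR (- c * N%:R).
Proof.
elim: N0 c0 => [|N0 IH] c0 c00 h h1; first by exists c0 => // N _; exact: h.
have [N00|N00] := posnP N0.
  by exists c0 => // N N1; apply: h; rewrite N00.
have [DN|DN] := boolP (D N0); last first.
  apply: (IH c0) => // N; rewrite leq_eqVlt => /predU1P[<-|]; last exact: h.
  by rewrite (negbTE DN).
have [c1 c10 hc1] : exists2 c1, 0 < c1 & p N0 <= expR (- c1 * N0%:R).
  have [p0|p0] := leP (p N0) 0.
    by exists 1 => //; rewrite (le_trans p0)// expR_ge0.
  exists (- ln (p N0) / N0%:R).
    by rewrite divr_gt0 ?ltr0n// oppr_gt0 ln_lt0// p0 h1.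
  have -> : - (- ln (p N0) / N0%:R) * N0%:R = ln (p N0).
    by field; rewrite pnatr_eq0 -lt0n.
  by rewrite lnK.
apply: (IH (Num.min c0 c1)) => //; first by rewrite lt_min c00.
move=> N; rewrite leq_eqVlt => /predU1P[<- _|NN dN].
  apply: (le_trans hc1); rewrite ler_expR ler_wpM2r// lerN2.
  by rewrite ge_min lexx orbT.
apply: (le_trans (h _ NN dN)); rewrite ler_expR ler_wpM2r// lerN2.
by rewrite ge_min lexx.
Qed.

End lpp_bounds.

(** * Concentration and almost sure convergence *)

Section concentration.
Context d (T : measurableType d) (R : realType) (P : probability T R).
Context (xi : nat * nat -> {RV P >-> R}) (alpha beta : R).
Hypotheses (alpha_gt0 : 0 < alpha) (beta_gt0 : 0 < beta).
Hypothesis xi_indep : mutually_independent pos_quadrant xi.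
Hypothesis xi_exp : identically_distributed pos_quadrant xi (exponential_prob alpha).
Let xif (y : nat * nat) : T -> R := xi y.
Let mxi y : measurable_fun setT (xif y).
Proof. exact: measurable_funP. Qed.
Let g : R := (1 + Num.sqrt beta) ^+ 2 / alpha.
Let M N : nat := Num.truncn (beta * N%:R).
Let G N u : R := last_passage (weights xif u) N (M N).

Lemma measurable_passage N : (0 < N)%N -> (0 < M N)%N -> measurable_fun setT (G N).
Proof.
case: N => // n _; rewrite /G; case: (M n.+1) => // m _.
rewrite (_ : (fun u => _) = fun u => lpp (wshift 1 1 (weights xif u)) n m).
  exact: measurable_lpp.
by apply/funext => u; rewrite last_passage_lpp.
Qed.

Lemma limit_gt0 : 0 < g.
Proof. by rewrite divr_gt0// exprn_gt0// ltr_pwDl// sqrtr_ge0. Qed.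

(** The event whose probability is to be bounded. *)
Definition deviation dl N : set T := [set u | dl < `| N%:R^-1 * G N u - g |].

Lemma measurable_deviation dl N : (0 < N)%N -> (0 < M N)%N ->
  measurable (deviation dl N).
Proof.
move=> N0 M0; apply: (@measurable_set_gt _ _ _ (fun u => `|N%:R^-1 * G N u - g|)).
apply: measurableT_comp => //; apply: measurable_funB => //.
by apply: measurable_funM => //; exact: measurable_passage.
Qed.

Lemma concentration_large dl : 0 < dl ->
  exists2 kp : R, 0 < kp & exists N0 : nat, forall N, (N0 <= N)%N ->
    (0 < N)%N -> (0 < M N)%N ->
    (P (deviation dl N) <= (expR (- kp * N%:R))%:E)%E.
Proof.
move=> dl0.
(* The critical rates for the direction [(1, beta)]. *)
pose sb := Num.sqrt beta.
have sb0 : 0 < sb by rewrite sqrtr_gt0.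
have sb2 : sb ^+ 2 = beta by rewrite sqr_sqrtr// ltW.
pose a := alpha / (1 + sb).
pose b := sb * a.
have sb1 : 0 < 1 + sb by rewrite addr_gt0.
have a0 : 0 < a by rewrite divr_gt0.
have b0 : 0 < b by rewrite mulr_gt0.
have abE : a + b = alpha by rewrite /b /a; field; rewrite gt_eqF.
have a2E : (a ^+ 2)^-1 = beta / b ^+ 2.
  have -> : b ^+ 2 = beta * a ^+ 2 by rewrite -sb2 -[RHS]exprMn.
  by rewrite [in RHS]invfM [RHS]mulrA divff ?mul1r// gt_eqF.
have gE (x : R) : g * x = x / a + beta * x / b.
  by rewrite /g -/sb /b /a -sb2; field; rewrite !gt_eqF.
clearbody b; clearbody a.
have C0 : 0 < 1 + beta by rewrite addr_gt0.
have dl2 : 0 < dl / 2 by rewrite divr_gt0.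
have e00 : 0 <= (b ^+ 2)^-1 by rewrite invr_ge0 sqr_ge0.
have [k1 k10 H1] := upper_tail alpha_gt0 xi_indep xi_exp a0 b0 abE C0 dl2.
have [k2 k20 [N2 H2]] := lower_tail alpha_gt0 xi_indep xi_exp a0 b0 abE C0 dl2 e00.
pose k := Num.min k1 k2.
have k0 : 0 < k by rewrite lt_min k10.
pose B := 7 + 3 * beta.
have B0 : 0 < B by rewrite addr_gt0// mulr_gt0.
have [N3 H3] := linear_exp B0 k0.
exists (k / 2); first by rewrite divr_gt0.
exists (Num.truncn (Num.max N2 (Num.max N3 (2 / (b * dl))))).+1 => N NN N0 M0.
have : Num.max N2 (Num.max N3 (2 / (b * dl))) <= N%:R.
  by rewrite ltW// (lt_le_trans (truncnS_gt _))// ler_nat.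
rewrite !ge_max => /and3P[N2N N3N N4N].
have Nr0 : 0 < N%:R :> R by rewrite ltr0n.
have bN0 : 0 <= beta * N%:R by rewrite mulr_ge0// ltW.
have Mle : (M N)%:R <= beta * N%:R by rewrite /M truncn_le.
have Mge : beta * N%:R < (M N)%:R + 1 by rewrite natr1; exact: truncnS_gt.
have NC : N%:R <= (1 + beta) * N%:R by rewrite mulrDl mul1r lerDl.
have MC : (M N)%:R <= (1 + beta) * N%:R.
  by rewrite mulrDl mul1r (le_trans Mle)// lerDr ltW.
(* The rounding of [beta * N] costs at most one unit in the second coordinate. *)
have bal1 : N%:R / a ^+ 2 <= (M N)%:R / b ^+ 2 + (b ^+ 2)^-1.
  rewrite a2E; set q := (b ^+ 2)^-1 in e00 *.
  have : 0 <= ((M N)%:R + 1 - beta * N%:R) * q by rewrite mulr_ge0// subr_ge0 ltW.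
  lra.
have bal2 : (M N)%:R / b ^+ 2 <= N%:R / a ^+ 2 + (b ^+ 2)^-1.
  rewrite a2E; set q := (b ^+ 2)^-1 in e00 *.
  have : 0 <= (beta * N%:R - (M N)%:R) * q by rewrite mulr_ge0// subr_ge0.
  lra.
have low : g * N%:R - b^-1 <= N%:R / a + (M N)%:R / b.
  rewrite gE; set q := b^-1.
  have : 0 <= ((M N)%:R + 1 - beta * N%:R) * q.
    by rewrite mulr_ge0 ?invr_ge0 ?subr_ge0// ltW.
  lra.
have upp : N%:R / a + (M N)%:R / b <= g * N%:R.
  by rewrite gE lerD2l ler_pM2r// invr_gt0.
have bdl : b^-1 <= dl / 2 * N%:R.
  move: N4N; rewrite ler_pdivrMr ?mulr_gt0// => h.
  by rewrite -[leLHS]mul1r ler_pdivrMr//; lra.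
clear Mge.
have GE u : G N u = lpp (wshift 1 1 (weights xif u)) N.-1 (M N).-1.
  by rewrite -last_passage_lpp !prednK.
have mG := measurable_passage N0 M0.
have p1 := H1 N 0 0 N.-1 (M N).-1.
rewrite !prednK// in p1; have {}p1 := p1 NC MC.
have p2 := H2 N N.-1 (M N).-1 N2N N0.
rewrite !prednK// in p2; have {}p2 := p2 NC MC bal1 bal2.
have x1 : expR (- (k1 * N%:R)) <= expR (- (k * N%:R)).
  by rewrite ler_expR lerN2 ler_wpM2r// ge_min lexx.
have x2 : expR (- (k2 * N%:R)) <= expR (- (k * N%:R)).
  by rewrite ler_expR lerN2 ler_wpM2r// ge_min lexx orbT.
rewrite mulNr; apply: le_trans (_ : (_ <= (B * N%:R * expR (- (k * N%:R)))%:E)%E) _; last first.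
  by rewrite lee_fin H3.
pose c1 : R := 2 * expR (- (k * N%:R)).
pose c2 : R := (2 + 3 * N%:R + 3 * (M N)%:R) * expR (- (k * N%:R)).
apply: (@le_trans _ _ (c1 + c2)%:E); last first.
  rewrite lee_fin /c1 /c2 -mulrDl ler_wpM2r ?expR_ge0// /B.
  have : 1 <= N%:R :> R by rewrite ler1n.
  lra.
apply: union_bound2 (le_trans p1 _) (le_trans p2 _).
- exact: measurable_deviation.
- by apply: measurable_set_ge; exact: measurable_lpp.
- by apply: measurable_set_le; exact: measurable_lpp.
- move=> u; rewrite /deviation /= => h.
  have {h} : dl * N%:R < `|G N u - g * N%:R|.
    have -> : G N u - g * N%:R = (N%:R^-1 * G N u - g) * N%:R.
      by rewrite [RHS]mulrBl [X in _ = X - _]mulrAC mulVf ?mul1r// gt_eqF.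
    by rewrite normrM (gtr0_norm Nr0) ltr_pM2r.
  rewrite GE; case: (ler0P (lpp (wshift 1 1 (weights xif u)) N.-1 (M N).-1 - g * N%:R)) => s h.
    by right; lra.
  by left; lra.
- by rewrite lee_fin ler_pM2l.
- by rewrite lee_fin ler_wpM2l// !addr_ge0// mulr_ge0.
Qed.

(** For each single [N] the deviation has probability less than 1: if all weights lie in
    [(v, v + t]], then the last passage value lies in [[L * v, L * (v + t)]], where [L] is
    the number of points of a path. *)
Lemma deviation_lt1 dl N : 0 < dl -> (0 < N)%N -> (0 < M N)%N ->
  (P (deviation dl N) < 1)%E.
Proof.
move=> dl0 N0 M0.
have mdev : measurable (deviation dl N) by exact: measurable_deviation.
pose n := N.-1; pose m := (M N).-1.
have NE : N = n.+1 by rewrite prednK.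
have ME : M N = m.+1 by rewrite prednK.
pose L : R := (n + m).+1%:R.
have L0 : 0 < L by rewrite ltr0n.
have Nr0 : 0 < N%:R :> R by rewrite ltr0n.
pose v := g * N%:R / L.
pose t := dl * N%:R / L.
have v0 : 0 < v by rewrite divr_gt0// mulr_gt0//; exact: limit_gt0.
have t0 : 0 < t by rewrite divr_gt0// mulr_gt0.
pose s := [seq y <- box n.+1 m.+1 | (0 < y.1)%N && (0 < y.2)%N].
have us : uniq s by rewrite filter_uniq// box_uniq.
have sD : {subset s <= pos_quadrant}.
  by move=> y; rewrite mem_filter => /andP[/andP[y1 y2] _]; rewrite inE; split.
have fs := expfam_xi alpha_gt0 xi_indep xi_exp us sD.
pose A : set R := `]v, v + t]%classic.
have mA : measurable A by exact: measurable_itv.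
have [_ _ is_ es] := fs.
have pA y : y \in s -> (0 < P (xif y @^-1` A))%E.
  move=> ys; have -> : xif y @^-1` A = [set u | v < xif y u] `\` [set u | v + t < xif y u].
    apply/seteqP; split => u /=; rewrite /A/= in_itv/=.
      by move=> /andP[-> h]; split=> //; rewrite ltNge h.
    by move=> [-> /negP]; rewrite -leNgt.
  have m1 r : measurable [set u | r < xif y u] by exact: measurable_set_gt.
  have -> : P ([set u | v < xif y u] `\` [set u | v + t < xif y u]) =
      (P [set u | (v < xif y u)%R] - P [set u | (v + t < xif y u)%R])%E.
    rewrite measureD//; last by rewrite (le_lt_trans (probability_le1 _ _))// ltry.
    by rewrite setIidr// => u /=; apply: lt_trans; rewrite ltrDl.
  have e1 : P [set u | v < xif y u] = _ := es _ ys v.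
  have e2 : P [set u | v + t < xif y u] = _ := es _ ys (v + t).
  rewrite e1 e2 -EFinB lte_fin subr_gt0 ltr_expR ltrN2 ltr_pM2l//.
  by rewrite !max_l ?ltrDl// ltW// addr_gt0.
have pS : (0 < P (rect s xif (fun=> A)))%E.
  rewrite is_// big_seq; elim/big_ind : _ => [|x y x0 y0|y ys].
  - by rewrite lte01.
  - exact: mule_gt0.
  - exact: pA.
have mS : measurable (rect s xif (fun=> A)) by exact: measurable_rect.
have sub : deviation dl N `<=` ~` rect s xif (fun=> A).
  move=> u du Su.
  have hu i j : (i <= n)%N -> (j <= m)%N ->
      v < wshift 1 1 (weights xif u) (i, j) <= v + t.
    move=> iN jM; rewrite /wshift /weights /= !addn1.
    have ys : (i.+1, j.+1) \in s by rewrite mem_filter mem_box /= !ltnS iN jM.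
    move: Su; rewrite /rect (bigD1_seq _ ys us)/= => -[+ _].
    by rewrite /A /= in_itv.
  have GE : last_passage (weights xif u) N (M N) = lpp (wshift 1 1 (weights xif u)) n m.
    by rewrite -last_passage_lpp -ME -NE.
  have {du} : dl < `|N%:R^-1 * last_passage (weights xif u) N (M N) - g| by exact: du.
  rewrite GE.
  have h1 := @lpp_ge_cst _ (wshift 1 1 (weights xif u)) n m v.
  have {}h1 := h1 (fun i j iN jM => ltW (proj1 (andP (hu i j iN jM)))).
  have h2 := @lpp_le_cst _ (wshift 1 1 (weights xif u)) n m (v + t).
  have {}h2 := h2 (fun i j iN jM => proj2 (andP (hu i j iN jM))).
  rewrite -/L in h1 h2.
  have vE : L * v = g * N%:R by rewrite /v mulrC divfK// gt_eqF.
  have tE : L * t = dl * N%:R by rewrite /t mulrC divfK// gt_eqF.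
  rewrite mulrDr vE tE in h2; rewrite vE in h1.
  rewrite ltNge => /negP; apply.
  set l := lpp _ _ _ in h1 h2 *.
  have -> : N%:R^-1 * l - g = (l - g * N%:R) / N%:R.
    by rewrite mulrBl mulfK ?gt_eqF// mulrC.
  have iN : 0 < N%:R^-1 :> R by rewrite invr_gt0.
  rewrite normrM (gtr0_norm iN) ler_pdivrMr//.
  by rewrite ger0_norm ?subr_ge0//; lra.
apply: (@le_lt_trans _ _ (P (~` rect s xif (fun=> A)))).
  by apply: le_measure; rewrite ?inE//; exact: measurableC.
have [c cE] := probability_nneg_num P mS.
by rewrite probability_setC// cE -EFinB lte_fin gtrBl; rewrite cE lte_fin in pS.
Qed.

Lemma concentration dl : 0 < dl ->
  exists2 c : R, 0 < c & forall N, (0 < N)%N -> (0 < M N)%N ->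
    (P (deviation dl N) <= (expR (- c * N%:R))%:E)%E.
Proof.
move=> dl0.
have [kp kp0 [N0 h]] := concentration_large dl0.
have fE N : (0 < N)%N -> (0 < M N)%N ->
    P (deviation dl N) = (fine (P (deviation dl N)))%:E.
  by move=> N1 M1; rewrite fineK// fin_num_measure//; exact: measurable_deviation.
have [||c c0 hc] := @uniform_rate R (fun N => fine (P (deviation dl N)))
  (fun N => (0 < N)%N && (0 < M N)%N) kp N0 kp0.
- by move=> N NN /andP[N1 M1]; rewrite -lee_fin -fE//; exact: h.
- by move=> N N1 /andP[_ M1]; rewrite -lte_fin -fE//; exact: deviation_lt1.
exists c => // N N1 M1; rewrite fE// lee_fin; apply: hc => //.
by rewrite N1 M1.
Qed.

(** Borel-Cantelli applied to the deviations larger than [k.+1%:R^-1], for each [k]. *)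
Lemma almost_sure_limit :
  {ae P, forall u, (fun N => N%:R^-1 * G N u) @ \oo --> g}.
Proof.
pose D N := (0 < N)%N && (0 < M N)%N.
pose A (k N : nat) := if D N then deviation k.+1%:R^-1 N else set0.
have mA k N : measurable (A k N).
  by rewrite /A; case: ifP => // /andP[N1 M1]; exact: measurable_deviation.
have A0 k : P (lim_sup_set (A k)) = 0%E.
  apply: lim_sup_set_cvg0 => //.
  have [c c0 hc] := concentration (ltac:(by rewrite invr_gt0) : 0 < k.+1%:R^-1).
  pose q := expR (- c).
  have q0 : 0 < q by exact: expR_gt0.
  have q1 : q < 1 by rewrite expR_lt1 oppr_lt0.
  apply: (@le_lt_trans _ _ (1 * (1 - q)^-1)%:E); last exact: ltry.
  apply: lime_le; first exact: is_cvg_nneseries.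
  apply: nearW => n.
  apply: (@le_trans _ _ (\sum_(0 <= i < n) (geometric 1 q i)%:E)%E).
    apply: lee_sum => i _; rewrite /A; case: ifP => [/andP[N1 M1]|_].
      by rewrite (le_trans (hc _ N1 M1))// lee_fin /geometric /= mul1r /q -expRM_natr.
    by rewrite measure0 lee_fin /geometric /= mul1r exprn_ge0// ltW.
  by rewrite sumEFin lee_fin geometric_le_lim// gtr0_norm.
have neg : P.-negligible (\bigcup_k lim_sup_set (A k)).
  apply: negligible_bigcup => k; apply/negligibleP; last exact: A0.
  by apply: bigcapT_measurable => i; exact: bigcup_measurable.
apply: negligibleS neg => u; rewrite /setC/=.
apply: contra_notP => hu.
apply/cvgrPdist_le => e e0.
pose k := Num.truncn e^-1.
have ke : k.+1%:R^-1 <= e.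
  by rewrite -[leRHS]invrK lef_pV2 ?posrE ?invr_gt0// ltW// truncnS_gt.
have [n0 hn0] : exists n0, forall N, (n0 <= N)%N -> ~ A k N u.
  apply: contrapT => h; apply: hu; exists k => // n _.
  apply: contrapT => h'; apply: h; exists n => N nN ANu.
  by apply: h'; exists N.
near=> N.
have nN : (n0 <= N)%N by near: N; exact: nbhs_infty_ge.
have N1 : (0 < N)%N by near: N; exact: nbhs_infty_gt.
have M1 : (0 < M N)%N.
  rewrite /M truncn_gt0.
  have : (Num.truncn beta^-1 < N)%N by near: N; exact: nbhs_infty_gt.
  move=> bN; rewrite -ler_pdivrMl// mulr1 ltW// (lt_le_trans (truncnS_gt _))//.
  by rewrite ler_nat.
have := hn0 N nN; rewrite /A /D N1 M1 /= /deviation /= => /negP; rewrite -leNgt.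
by rewrite distrC => /le_trans; apply.
Unshelve. all: by end_near.
Qed.

End concentration.

Theorem theorem2p2 (R : realType) (d : measure_display) (T : measurableType d)
    (P : probability T R) (xi : nat * nat -> {RV P >-> R}) (alpha beta : R)
    (alpha_gt0 : 0 < alpha) (beta_gt0 : 0 < beta)
    (xi_indep : mutually_independent pos_quadrant xi)
    (xi_exp : identically_distributed pos_quadrant xi (exponential_prob alpha)) :
  let G (N M : nat) (omega : T) := last_passage (fun y => xi y omega) N M in
  {ae P, forall omega,
    (fun N : nat => N%:R^-1 * G N (Num.truncn (beta * N%:R)) omega) @ \oo
      --> (1 + Num.sqrt beta) ^+ 2 / alpha} /\
  (forall delta : R, 0 < delta ->
    exists2 c : R, 0 < c &
      forall N : nat, (1 <= N)%N -> (1 <= Num.truncn (beta * N%:R))%N ->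
        (P [set omega | (delta <
              `| N%:R^-1 * G N (Num.truncn (beta * N%:R)) omega
                 - (1 + Num.sqrt beta) ^+ 2 / alpha |)%R]
         <= (expR (- c * N%:R))%:E)%E).

Proof.
move=> G; split; first exact: almost_sure_limit.
move=> delta delta0.
have [c c0 hc] := concentration alpha_gt0 beta_gt0 xi_indep xi_exp delta0.
by exists c => // N N1 M1; exact: hc.
Qed.
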